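(* Let $\mathcal{M}$ be a Wright factor with trace $\tau$. If $T\in\mathcal{M}$ is normal with $\tau(T)=0$, then $T\in\operatorname{Comm}(\mathcal{M})$; that is, there exist $B,C\in\mathcal{M}$ such that $T=BC-CB$.
   Context: For an algebra $\mathfrak{A}$, the commutator of $B,C\in\mathfrak{A}$ is $[B,C]=BC-CB$, and $\operatorname{Comm}(\mathfrak{A})=\{[B,C] : B,C\in\mathfrak{A}\}$ is the set of all (single) commutators. Let $\operatorname{tr}_n$ denote the trace on $M_n(\mathbf{C})$ normalized so that $\operatorname{tr}_n(1)=1$. A Wright factor is a II$_1$-factor of the following form: let $\omega$ be a nontrivial (i.e. non-principal) ultrafilter on the natural numbers, and let $\mathcal{M}$ be the quotient of the von Neumann algebra of all (norm-)bounded sequences in $\prod_{n=1}^\infty M_n(\mathbf{C})$ by the ideal $I_\omega$ consisting of all such bounded sequences $(a_n)_{n=1}^\infty$ with $\lim_{n\to\omega}\operatorname{tr}_n(a_n^*a_n)=0$. The trace $\tau$ on $\mathcal{M}$ (normalized so that $\tau(1)=1$) sends the element associated to a bounded sequence $(b_n)_{n=1}^\infty$ to $\lim_{n\to\omega}\operatorname{tr}_n(b_n)$. *)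

(* Defs.v *)
From HB Require Import structures.
From mathcomp Require Import all_boot all_order all_algebra.
From mathcomp Require Import complex ring lra.
From mathcomp Require Import all_classical all_reals all_analysis.

Set Implicit Arguments.
Unset Strict Implicit.
Unset Printing Implicit Defensive.

Import Order.TTheory GRing.Theory Num.Theory.
Import numFieldNormedType.Exports.
Import Normc.

Local Open Scope classical_set_scope.
Local Open Scope quotient_scope.
Local Open Scope ring_scope.
Local Open Scope sesquilinear_scope.

Definition commutator (A : pzRingType) (B C : A) : A := B * C - C * B.

Definition Comm (A : pzRingType) : set A :=
  [set T | exists B C : A, T = commutator B C].
Arguments Comm : clear implicits.

Definition nonprincipal (X : Type) (U : set_system X) : Prop :=
  forall x : X, U <> principal_filter x.

Definition l2norm (R : realType) (n : nat) (v : 'cV[R[i]]_n) : R :=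
  Num.sqrt (\sum_(i < n) normc (v i 0) ^+ 2).

(* Operator norm on M_n(C) for the Euclidean norm of C^n; the library norm on
   matrices is the entrywise maximum. *)
Definition opnorm (R : realType) (n : nat) (A : 'M[R[i]]_n) : R :=
  sup [set l2norm (A *m v) | v in [set v : 'cV[R[i]]_n | l2norm v <= 1]].

(* Only meant for n > 0: the division makes it 0 on the zero algebra 'M_0. *)
Definition ntr (R : realType) (n : nat) (A : 'M[R[i]]_n) : R[i] :=
  \tr A / n%:R.

(* The adjoint A^*; naming it keeps its entries in R[i] syntactically. *)
Definition ctrmx (R : realType) (m n : nat) (A : 'M[R[i]]_(m, n)) :
  'M[R[i]]_(n, m) := A ^t*.

Section FrobeniusNorm.
Variable R : realType.
Local Notation C := R[i].
Implicit Types (m n p : nat).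

Lemma sqr_normc (z : C) : normc z ^+ 2 = complex.Re z ^+ 2 + complex.Im z ^+ 2.
Proof. by case: z => a b /=; rewrite sqr_sqrtr// addr_ge0// sqr_ge0. Qed.

Lemma normc_ge0 (z : C) : 0 <= normc z.
Proof. by case: z => a b; exact: sqrtr_ge0. Qed.

Lemma mul_conj_normc (z : C) : z^* * z = (normc z ^+ 2)%:C%C.
Proof.
rewrite sqr_normc; case: z => a b.
by apply/eqP; rewrite eq_complex /=; apply/andP; split; apply/eqP; ring.
Qed.

Lemma normc_conj (z : C) : normc z^* = normc z.
Proof. by case: z => a b /=; rewrite sqrrN. Qed.

Lemma normcD (x y : C) : (normc (x + y) : R) <= (normc x : R) + (normc y : R).
Proof. exact: le_normcD. Qed.

Lemma normc_sum (I : Type) (s : seq I) (F : I -> C) :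
  normc (\sum_(i <- s) F i) <= \sum_(i <- s) normc (F i).
Proof.
elim: s => [|i s ih]; first by rewrite !big_nil normc0.
by rewrite !big_cons (le_trans (normcD _ _))// lerD2l.
Qed.

Lemma sum_cauchy_schwarz (I : finType) (a b : I -> R) :
  (\sum_i a i * b i) ^+ 2 <= (\sum_i a i ^+ 2) * (\sum_i b i ^+ 2).
Proof.
have : 0 <= \sum_i \sum_j (a i * b j - a j * b i) ^+ 2.
  by apply: sumr_ge0 => i _; apply: sumr_ge0 => j _; exact: sqr_ge0.
have -> : \sum_i \sum_j (a i * b j - a j * b i) ^+ 2 =
    \sum_i \sum_j a i ^+ 2 * b j ^+ 2 + \sum_i \sum_j a j ^+ 2 * b i ^+ 2
    - \sum_i \sum_j (a i * b i) * (a j * b j) *+ 2.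
  rewrite -big_split -sumrB; apply: eq_bigr => i _.
  by rewrite -big_split -sumrB; apply: eq_bigr => j _ /=; ring.
rewrite [X in _ + X - _]exchange_big /=.
have -> : \sum_i \sum_j (a i * b i) * (a j * b j) *+ 2 =
    (\sum_i a i * b i) ^+ 2 *+ 2.
  rewrite expr2 big_distrlr /= -sumrMnl.
  by apply: eq_bigr => i _; rewrite sumrMnl.
by rewrite -!big_distrlr /=; lra.
Qed.

(* Squared, unnormalised Hilbert-Schmidt norm. *)
Definition frob2 m n (A : 'M[C]_(m, n)) : R :=
  \sum_i \sum_j normc (A i j) ^+ 2.

Lemma frob2_ge0 m n (A : 'M[C]_(m, n)) : 0 <= frob2 A.
Proof. by apply: sumr_ge0 => i _; apply: sumr_ge0 => j _; exact: sqr_ge0. Qed.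

Lemma frob2_eq0 m n (A : 'M[C]_(m, n)) : frob2 A = 0 -> A = 0.
Proof.
move=> A0; apply/matrixP => i j; rewrite mxE; apply: eq0_normc.
have rge0 k : true -> 0 <= \sum_l normc (A k l) ^+ 2.
  by move=> _; apply: sumr_ge0 => l _; exact: sqr_ge0.
have /eqP := psumr_eq0P rge0 A0 (i := i) isT.
rewrite psumr_eq0; last by move=> l _; exact: sqr_ge0.
by move=> /allP/(_ j (mem_index_enum _)); rewrite sqrf_eq0 => /eqP.
Qed.

Lemma frob2_l2norm n (v : 'cV[C]_n) : l2norm v ^+ 2 = frob2 v.
Proof.
rewrite /l2norm sqr_sqrtr; last by apply: sumr_ge0 => i _; exact: sqr_ge0.
by apply: eq_bigr => i _; rewrite big_ord1.
Qed.

Lemma l2norm_ge0 n (v : 'cV[C]_n) : 0 <= l2norm v.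
Proof. exact: sqrtr_ge0. Qed.

Lemma ctrmxE m n (A : 'M[C]_(m, n)) i j : ctrmx A i j = (A j i)^*.
Proof. by rewrite !mxE. Qed.

Lemma ctrmxK m n (A : 'M[C]_(m, n)) : ctrmx (ctrmx A) = A.
Proof. exact: trmxCK. Qed.

Lemma ctrmxM m n p (A : 'M[C]_(m, n)) (B : 'M[C]_(n, p)) :
  ctrmx (A *m B) = ctrmx B *m ctrmx A.
Proof. by rewrite /ctrmx trmx_mul map_mxM. Qed.

Lemma ctrmx1 n : ctrmx (1%:M : 'M[C]_n) = 1%:M.
Proof. by rewrite /ctrmx trmx1 map_mx1. Qed.

Lemma frob2_adj m n (A : 'M[C]_(m, n)) : frob2 (ctrmx A) = frob2 A.
Proof.
rewrite /frob2 exchange_big; apply: eq_bigr => i _; apply: eq_bigr => j _.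
by rewrite ctrmxE normc_conj.
Qed.

Lemma frob2Z m n a (A : 'M[C]_(m, n)) : frob2 (a *: A) = normc a ^+ 2 * frob2 A.
Proof.
rewrite /frob2 mulr_sumr; apply: eq_bigr => i _; rewrite mulr_sumr.
by apply: eq_bigr => j _; rewrite !mxE normcM exprMn.
Qed.

Lemma frob2D m n (A B : 'M[C]_(m, n)) :
  frob2 (A + B) <= 2 * (frob2 A + frob2 B).
Proof.
rewrite /frob2 -big_split mulr_sumr; apply: ler_sum => i _ /=.
rewrite -big_split mulr_sumr; apply: ler_sum => j _ /=.
rewrite mxE; have := normcD (A i j) (B i j).
move: (normc_ge0 (A i j)) (normc_ge0 (B i j)) (normc_ge0 (A i j + B i j)).
move: (normc (A i j) : R) (normc (B i j) : R) (normc (A i j + B i j) : R).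
move=> x y z x0 y0 z0 zxy.
have : z ^+ 2 <= (x + y) ^+ 2 by rewrite ler_pXn2r ?nnegrE ?addr_ge0.
move=> h; apply: (le_trans h); rewrite -subr_ge0.
have -> : 2 * (x ^+ 2 + y ^+ 2) - (x + y) ^+ 2 = (x - y) ^+ 2 by ring.
exact: sqr_ge0.
Qed.

Lemma frob2M m n p (A : 'M[C]_(m, n)) (B : 'M[C]_(n, p)) :
  frob2 (A *m B) <= frob2 A * frob2 B.
Proof.
rewrite /frob2 [X in _ <= _ * X]exchange_big /= big_distrlr /=.
apply: ler_sum => i _; apply: ler_sum => j _; rewrite mxE.
apply: le_trans (sum_cauchy_schwarz _ _).
rewrite ler_pXn2r ?nnegrE ?normc_ge0//; last first.
  by apply: sumr_ge0 => k _; rewrite mulr_ge0 ?normc_ge0.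
apply: (le_trans (normc_sum _ _)).
by apply: ler_sum => k _; rewrite normcM.
Qed.

Lemma trace_adj_mul m n (A : 'M[C]_(m, n)) : \tr (ctrmx A *m A) = (frob2 A)%:C%C.
Proof.
rewrite /frob2 exchange_big /= rmorph_sum; apply: eq_bigr => j _.
rewrite mxE rmorph_sum; apply: eq_bigr => i _.
by rewrite ctrmxE mul_conj_normc.
Qed.

Lemma frob2_1 n : frob2 (1%:M : 'M[C]_n) = n%:R.
Proof.
have := trace_adj_mul (1%:M : 'M[C]_n).
rewrite ctrmx1 mulmx1 mxtrace1 -[in LHS](rmorph_nat (real_complex R)).
by move=> /(@complexI R).
Qed.

End FrobeniusNorm.

Section OperatorNorm.
Variable R : realType.
Local Notation C := R[i].
Variable n : nat.
Implicit Types (A B : 'M[C]_n) (v : 'cV[C]_n).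

Lemma l2normZ a v : l2norm (a *: v) = normc a * l2norm v.
Proof.
apply/eqP; rewrite -(@eqrXn2 _ 2)// ?mulr_ge0 ?l2norm_ge0 ?normc_ge0//.
by rewrite frob2_l2norm frob2Z exprMn frob2_l2norm.
Qed.

Lemma opnorm_has_sup A :
  has_sup [set l2norm (A *m v) | v in [set v : 'cV[C]_n | l2norm v <= 1]].
Proof.
have l20 : l2norm (0 : 'cV[C]_n) = 0 by rewrite -(scale0r 0) l2normZ normc0 mul0r.
split; first by exists (l2norm (A *m 0)), 0 => //=; rewrite l20.
exists (frob2 A + 1) => _ [v /= v1 <-].
have h : l2norm (A *m v) ^+ 2 <= frob2 A.
  rewrite frob2_l2norm (le_trans (frob2M _ _))// -[leRHS]mulr1.
  by rewrite ler_wpM2l ?frob2_ge0// -frob2_l2norm expr_le1// l2norm_ge0.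
move: (l2norm_ge0 (A *m v)) (frob2_ge0 A) h; nra.
Qed.

Lemma opnorm_ge0 A : 0 <= opnorm A.
Proof.
apply: (@le_trans _ _ (l2norm (A *m 0))); first exact: l2norm_ge0.
apply: ub_le_sup; first exact: (opnorm_has_sup A).2.
by exists 0 => //=; rewrite -(scale0r 0) l2normZ normc0 mul0r.
Qed.

Lemma opnormP A v : l2norm (A *m v) <= opnorm A * l2norm v.
Proof.
have [v0|v0] := eqVneq (l2norm v) 0.
  have -> : v = 0 by apply: frob2_eq0; rewrite -frob2_l2norm v0 expr0n.
  by rewrite mulmx0 -(scale0r 0) l2normZ normc0 !mul0r mulr0.
have v1 : 0 < l2norm v by rewrite lt0r v0 l2norm_ge0.
have nv : normc ((l2norm v)^-1)%:C%C = (l2norm v)^-1.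
  by rewrite /= expr0n addr0 sqrtr_sqr ger0_norm// invr_ge0 ltW.
rewrite -ler_pdivrMr// mulrC -nv -l2normZ scalemxAr.
apply: ub_le_sup; first exact: (opnorm_has_sup A).2.
by eexists; [|reflexivity]; rewrite /= l2normZ nv mulVf.
Qed.

Lemma opnorm_le A K :
  0 <= K -> (forall v, l2norm (A *m v) <= K * l2norm v) -> opnorm A <= K.
Proof.
move=> K0 AK; apply: ge_sup; first exact: (opnorm_has_sup A).1.
by move=> _ [v /= v1 <-]; rewrite (le_trans (AK v))// ler_piMr.
Qed.

Lemma frob2_opnorm p A (B : 'M[C]_(n, p)) :
  frob2 (A *m B) <= opnorm A ^+ 2 * frob2 B.
Proof.
have frobE q (D : 'M[C]_(n, q)) : frob2 D = \sum_j frob2 (col j D).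
  rewrite /frob2 exchange_big; apply: eq_bigr => j _; apply: eq_bigr => i _.
  by rewrite big_ord1 mxE.
rewrite !frobE mulr_sumr; apply: ler_sum => j _.
rewrite -!frob2_l2norm -exprMn ler_pXn2r ?nnegrE ?l2norm_ge0//.
  by rewrite !colE -mulmxA opnormP.
by rewrite mulr_ge0 ?opnorm_ge0 ?l2norm_ge0.
Qed.

End OperatorNorm.

Section OperatorNormTheory.
Variable R : realType.
Local Notation C := R[i].
Variable n : nat.
Implicit Types A B : 'M[C]_n.

Lemma opnormZ_le a A : opnorm (a *: A) <= normc a * opnorm A.
Proof.
apply: opnorm_le => [|v]; first by rewrite mulr_ge0 ?normc_ge0 ?opnorm_ge0.
by rewrite -scalemxAl l2normZ -mulrA ler_wpM2l ?normc_ge0 ?opnormP.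
Qed.

Lemma opnormD_le A B : opnorm (A + B) <= 2 * (opnorm A + opnorm B).
Proof.
have K0 : 0 <= 2 * (opnorm A + opnorm B).
  by rewrite mulr_ge0 ?addr_ge0 ?opnorm_ge0.
apply: opnorm_le => // v.
rewrite -(@ler_pXn2r _ 2)// ?nnegrE ?mulr_ge0 ?addr_ge0 ?l2norm_ge0
  ?opnorm_ge0//.
rewrite mulmxDl frob2_l2norm (le_trans (frob2D _ _))// -!frob2_l2norm exprMn.
have h (D : 'M[C]_n) : l2norm (D *m v) ^+ 2 <= opnorm D ^+ 2 * l2norm v ^+ 2.
  by rewrite !frob2_l2norm frob2_opnorm.
apply: (@le_trans _ _ (2 * ((opnorm A ^+ 2 + opnorm B ^+ 2) * l2norm v ^+ 2))).
  by rewrite ler_pM2l// mulrDl lerD.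
rewrite mulrA ler_wpM2r ?sqr_ge0// -subr_ge0.
move: (opnorm_ge0 A) (opnorm_ge0 B); move: (opnorm A) (opnorm B) => a b a0 b0.
rewrite (_ : _ - _ = 2 * (a ^+ 2 + b ^+ 2) + 8 * (a * b)); last by ring.
by rewrite !(addr_ge0, mulr_ge0, sqr_ge0).
Qed.

Lemma opnormM_le A B : opnorm (A *m B) <= opnorm A * opnorm B.
Proof.
apply: opnorm_le => [|v]; first by rewrite mulr_ge0 ?opnorm_ge0.
rewrite -mulmxA (le_trans (opnormP _ _))// -mulrA.
by rewrite ler_wpM2l ?opnorm_ge0 ?opnormP.
Qed.

Lemma opnorm1_le : opnorm (1%:M : 'M[C]_n) <= 1.
Proof. by apply: opnorm_le => // v; rewrite mul1mx mul1r. Qed.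

Lemma l2norm_dot (v w : 'cV[C]_n) :
  normc (\tr (ctrmx v *m w)) <= l2norm v * l2norm w.
Proof.
rewrite -(@ler_pXn2r _ 2)// ?nnegrE ?mulr_ge0 ?normc_ge0 ?l2norm_ge0//.
rewrite exprMn !frob2_l2norm -(frob2_adj v).
apply: le_trans (frob2M _ _).
by rewrite /frob2 !big_ord1 trace_mx11.
Qed.

Lemma opnorm_adj_le A : opnorm (ctrmx A) <= opnorm A.
Proof.
apply: opnorm_le => [|v]; first exact: opnorm_ge0.
have [->|w0] := eqVneq (l2norm (ctrmx A *m v)) 0.
  by rewrite mulr_ge0 ?opnorm_ge0 ?l2norm_ge0.
have wgt0 : 0 < l2norm (ctrmx A *m v) by rewrite lt0r w0 l2norm_ge0.
rewrite -(ler_pM2r wgt0) -expr2 frob2_l2norm.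
have -> : frob2 (ctrmx A *m v) = normc (\tr (ctrmx v *m (A *m (ctrmx A *m v)))).
  have -> : ctrmx v *m (A *m (ctrmx A *m v)) = ctrmx (ctrmx A *m v) *m (ctrmx A *m v).
    by rewrite ctrmxM ctrmxK -mulmxA.
  by rewrite trace_adj_mul /= expr0n addr0 sqrtr_sqr ger0_norm ?frob2_ge0.
rewrite (le_trans (l2norm_dot _ _))// [leRHS]mulrAC [leRHS]mulrC.
by rewrite ler_wpM2l ?l2norm_ge0// opnormP.
Qed.

Lemma normc_ntr A : normc (ntr A) ^+ 2 <= frob2 A / n%:R.
Proof.
have nC : (n%:R : C) = (n%:R : R)%:C%C by rewrite rmorph_nat.
have [n0|n0] := eqVneq (n%:R : R) 0.
  by rewrite /ntr nC n0 !invr0 !mulr0 normc0 expr0n.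
have ngt0 : 0 < n%:R :> R by rewrite lt0r n0 ler0n.
have nn : normc (n%:R : C)^-1 = (n%:R : R)^-1.
  by rewrite normcV nC /= expr0n addr0 sqrtr_sqr ger0_norm// ler0n.
rewrite /ntr normcM nn exprMn [X in _ * X]expr2 mulrA.
rewrite ler_wpM2r ?invr_ge0 ?ler0n// ler_pdivrMr//.
have cs : normc (\tr A) ^+ 2 <= (\sum_(i < n) 1 ^+ 2) * \sum_i normc (A i i) ^+ 2.
  apply: le_trans (sum_cauchy_schwarz _ _).
  rewrite ler_pXn2r ?nnegrE ?normc_ge0//.
    apply: (le_trans (normc_sum _ _)).
    by under [leRHS]eq_bigr do rewrite mul1r.
  by apply: sumr_ge0 => i _; rewrite mul1r normc_ge0.
apply: (le_trans cs); under eq_bigr do rewrite expr1n.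
rewrite sumr_const card_ord mulrC ler_wpM2r ?ler0n//.
apply: ler_sum => i _; rewrite (bigD1 i)//= lerDl.
by apply: sumr_ge0 => j _; exact: sqr_ge0.
Qed.

End OperatorNormTheory.

Lemma normc_ntr_opnorm (R : realType) (m : nat) (A : 'M[R[i]]_m.+1) :
  normc (ntr A) <= opnorm A.
Proof.
rewrite -(@ler_pXn2r _ 2)// ?nnegrE ?normc_ge0 ?opnorm_ge0//.
have h : frob2 A <= opnorm A ^+ 2 * m.+1%:R.
  by have := frob2_opnorm A (1%:M : 'M[R[i]]_m.+1); rewrite mulmx1 frob2_1.
by rewrite (le_trans (normc_ntr A))// ler_pdivrMr.
Qed.

(* Indices are shifted by one: the n-th term lies in M_(n+1)(C), so that n : nat
   enumerates the sizes 1, 2, 3, ... *)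
Definition matseq (R : realType) : Type := forall n : nat, 'M[R[i]]_n.+1.

Section MatrixSequences.
Variable R : realType.
Implicit Types (a b c : matseq R) (z w : R[i]).

HB.instance Definition _ := gen_eqMixin (matseq R).
HB.instance Definition _ := gen_choiceMixin (matseq R).

Lemma matseqP a b : (forall n, a n = b n) -> a = b.
Proof. exact: functional_extensionality_dep. Qed.

Let ms_zero : matseq R := fun n => 0.
Let ms_opp a : matseq R := fun n => - a n.
Let ms_add a b : matseq R := fun n => a n + b n.
Let ms_one : matseq R := fun n => 1.
Let ms_mul a b : matseq R := fun n => a n * b n.
Let ms_scale z a : matseq R := fun n => z *: a n.

Fact ms_addA : associative ms_add.
Proof. by move=> a b c; apply: matseqP => n; exact: addrA. Qed.
Fact ms_addC : commutative ms_add.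
Proof. by move=> a b; apply: matseqP => n; exact: addrC. Qed.
Fact ms_add0 : left_id ms_zero ms_add.
Proof. by move=> a; apply: matseqP => n; exact: add0r. Qed.
Fact ms_addN : left_inverse ms_zero ms_opp ms_add.
Proof. by move=> a; apply: matseqP => n; exact: addNr. Qed.
HB.instance Definition _ :=
  GRing.isZmodule.Build (matseq R) ms_addA ms_addC ms_add0 ms_addN.

Fact ms_mulA : associative ms_mul.
Proof. by move=> a b c; apply: matseqP => n; exact: mulrA. Qed.
Fact ms_mul1l : left_id ms_one ms_mul.
Proof. by move=> a; apply: matseqP => n; exact: mul1r. Qed.
Fact ms_mul1r : right_id ms_one ms_mul.
Proof. by move=> a; apply: matseqP => n; exact: mulr1. Qed.
Fact ms_mulDl : left_distributive ms_mul +%R.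
Proof. by move=> a b c; apply: matseqP => n; exact: mulrDl. Qed.
Fact ms_mulDr : right_distributive ms_mul +%R.
Proof. by move=> a b c; apply: matseqP => n; exact: mulrDr. Qed.
Fact ms_one_neq0 : ms_one != 0.
Proof.
apply/eqP => /(congr1 (fun a : matseq R => a 0%N)) /eqP.
by rewrite (oner_eq0 'M[R[i]]_1).
Qed.
HB.instance Definition _ := GRing.Zmodule_isNzRing.Build (matseq R)
  ms_mulA ms_mul1l ms_mul1r ms_mulDl ms_mulDr ms_one_neq0.

Fact ms_scaleA z w a : ms_scale z (ms_scale w a) = ms_scale (z * w) a.
Proof. by apply: matseqP => n; exact: scalerA. Qed.
Fact ms_scale1 : left_id 1 ms_scale.
Proof. by move=> a; apply: matseqP => n; exact: scale1r. Qed.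
Fact ms_scaleDr : right_distributive ms_scale +%R.
Proof. by move=> z a b; apply: matseqP => n; exact: scalerDr. Qed.
Fact ms_scaleDl a : {morph ms_scale^~ a : z w / z + w}.
Proof. by move=> z w; apply: matseqP => n; exact: scalerDl. Qed.
HB.instance Definition _ := GRing.Zmodule_isLmodule.Build R[i] (matseq R)
  ms_scaleA ms_scale1 ms_scaleDr ms_scaleDl.

Fact ms_scaleAl z a b : z *: (a * b) = (z *: a) * b.
Proof. by apply: matseqP => n; exact: scalerAl. Qed.
HB.instance Definition _ :=
  GRing.Lmodule_isLalgebra.Build R[i] (matseq R) ms_scaleAl.
Fact ms_scaleAr z a b : z *: (a * b) = a * (z *: b).
Proof. by apply: matseqP => n; exact: scalerAr. Qed.
HB.instance Definition _ :=
  GRing.Lalgebra_isAlgebra.Build R[i] (matseq R) ms_scaleAr.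

Definition norm_bounded : {pred matseq R} :=
  [pred a | `[< exists K : R, forall n, opnorm (a n) <= K >]].

Lemma norm_boundedP a :
  reflect (exists K : R, forall n, opnorm (a n) <= K) (a \in norm_bounded).
Proof. exact: asboolP. Qed.

Fact norm_bounded_subalg : subalg_closed norm_bounded.
Proof.
split.
- by apply/norm_boundedP; exists 1 => n; exact: opnorm1_le.
- move=> z a b /norm_boundedP[K aK] /norm_boundedP[L bL]; apply/norm_boundedP.
  exists (2 * (normc z * K + L)) => n.
  rewrite (le_trans (opnormD_le _ _))// ler_wpM2l// lerD//.
  by rewrite (le_trans (opnormZ_le _ _))// ler_wpM2l ?normc_ge0.
- move=> a b /norm_boundedP[K aK] /norm_boundedP[L bL]; apply/norm_boundedP.
  exists (K * L) => n; rewrite (le_trans (opnormM_le _ _))//.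
  by rewrite ler_pM ?opnorm_ge0.
Qed.
HB.instance Definition _ := GRing.isSubalgClosed.Build R[i] (matseq R)
  norm_bounded (GRing.subalg_closed_semi norm_bounded_subalg).

End MatrixSequences.

Record bseq (R : realType) : Type :=
  Bseq { seq_of_bseq :> forall n : nat, 'M[R[i]]_n.+1 ;
         _ : (seq_of_bseq : matseq R) \in @norm_bounded R }.

Section BoundedSequences.
Variable R : realType.

HB.instance Definition _ := [isSub for (@seq_of_bseq R : bseq R -> matseq R)].
HB.instance Definition _ := [Choice of bseq R by <:].
HB.instance Definition _ := [SubChoice_isSubAlgebra of bseq R by <:].

Implicit Types a b : bseq R.

Lemma bseqP a : exists K : R, forall n, opnorm (a n) <= K.
Proof. exact/norm_boundedP/(valP a). Qed.

Fact bseq_star_bounded a : (fun n => ctrmx (a n)) \in @norm_bounded R.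
Proof.
have [K aK] := bseqP a; apply/norm_boundedP; exists K => n.
exact: le_trans (opnorm_adj_le _) (aK n).
Qed.

Definition bseq_star a : bseq R := Bseq (bseq_star_bounded a).

Lemma bseq_starD a b : bseq_star (a + b) = bseq_star a + bseq_star b.
Proof.
apply/val_inj/matseqP => n; apply/matrixP => i j.
by rewrite /= !(ctrmxE, mxE) rmorphD.
Qed.

Lemma bseq_starN a : bseq_star (- a) = - bseq_star a.
Proof.
apply/val_inj/matseqP => n; apply/matrixP => i j.
by rewrite /= !(ctrmxE, mxE) rmorphN.
Qed.

Lemma bseq_starM a b : bseq_star (a * b) = bseq_star b * bseq_star a.
Proof. by apply/val_inj/matseqP => n; exact: ctrmxM. Qed.

Lemma bseq_starK : involutive bseq_star.
Proof. by move=> a; apply/val_inj/matseqP => n; exact: ctrmxK. Qed.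

End BoundedSequences.

Section WrightFactor.
Variables (R : realType) (U : set_system nat) (FU : UltraFilter U).
Local Notation C := R[i].
Implicit Types a b c : bseq R.

#[local] Instance ultra_filter : ProperFilter U := @ultra_proper _ _ FU.

(* The ideal I_U.  The limit is taken in C^o, which carries the topology of C.
   The ultrafilter proof is an argument so that the closure instances below can
   be inferred from the predicate alone. *)
Definition null_seq of UltraFilter U : {pred bseq R} :=
  [pred a : bseq R |
    `[< ((ntr (ctrmx (a n) *m a n) : C^o) @[n --> U] --> (0 : C^o)) >]].

Lemma null_seqP a : reflect
  (forall e : R, 0 < e -> \forall n \near U, frob2 (a n) / n.+1%:R < e)
  (a \in null_seq FU).
Proof.
have ntrE n : ntr (ctrmx (a n) *m a n) = (frob2 (a n) / n.+1%:R)%:C%C.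
  by rewrite /ntr trace_adj_mul rmorphM fmorphV rmorph_nat.
have normE n : `|ntr (ctrmx (a n) *m a n)| = (frob2 (a n) / n.+1%:R)%:C%C.
  by rewrite ntrE ger0_norm// lecR divr_ge0 ?frob2_ge0.
apply: (iffP (asboolP _)) => [a0 e e0|a0].
  have /(_ _ e%:C%C) := (@cvgr0Pnorm_lt C C^o _ _ _ _).1 a0.
  rewrite ltcR => /(_ e0); apply: filterS => n.
  by rewrite normE ltcR.
apply/(@cvgr0Pnorm_lt C C^o) => e e0.
have [eim ere] : complex.Im e = 0 /\ 0 < complex.Re e.
  by move: e0; rewrite ltcE /= => /andP[/eqP-> ->].
have -> : e = (complex.Re e)%:C%C by rewrite [LHS]complexE eim mulr0 addr0.
apply: filterS (a0 _ ere) => n.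
by rewrite normE ltcR.
Qed.

Fact null_seq_zmod : zmod_closed (null_seq FU).
Proof.
split.
  apply/null_seqP => e e0; apply: filterE => n /=.
  have -> : frob2 (0 : 'M[C]_n.+1) = 0.
    by rewrite -(scale0r 0) frob2Z normc0 expr0n mul0r.
  by rewrite mul0r.
move=> a b /null_seqP a0 /null_seqP b0; apply/null_seqP => e e0.
have e4 : 0 < e / 4 by rewrite divr_gt0.
apply: (filterS _ (filterI (a0 _ e4) (b0 _ e4))) => n [] /= an bn.
have bN : frob2 (- b n) = frob2 (b n).
  rewrite -scaleN1r frob2Z /= sqrrN expr1n oppr0 expr0n addr0 sqrtr1.
  by rewrite expr1n mul1r.
apply: (@le_lt_trans _ _ (2 * (frob2 (a n) + frob2 (b n)) / n.+1%:R)).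
  by rewrite ler_wpM2r ?invr_ge0// -bN frob2D.
rewrite -mulrA [X in 2 * X]mulrDl; move: an bn.
move: (frob2 (a n) / _ : R) (frob2 (b n) / _ : R) => x y; lra.
Qed.

HB.instance Definition _ :=
  GRing.isZmodClosed.Build (bseq R) (null_seq FU) null_seq_zmod.

Lemma null_seqMl a b : b \in null_seq FU -> a * b \in null_seq FU.
Proof.
move=> /null_seqP b0; apply/null_seqP => e e0.
have [K aK] := bseqP a.
have K0 : 0 <= K by exact: le_trans (opnorm_ge0 _) (aK 0%N).
have e1 : 0 < e / (K ^+ 2 + 1) by rewrite divr_gt0// ltr_wpDl ?sqr_ge0.
apply: filterS (b0 _ e1) => n.
rewrite ltr_pdivlMr; last by rewrite ltr_wpDl ?sqr_ge0.
apply: le_lt_trans.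
apply: (@le_trans _ _ (K ^+ 2 * frob2 (b n) / n.+1%:R)).
  rewrite ler_wpM2r ?invr_ge0//.
  apply: le_trans (frob2_opnorm _ _) _.
  by rewrite ler_wpM2r ?frob2_ge0// ler_pXn2r ?nnegrE ?opnorm_ge0.
rewrite -mulrA mulrC ler_wpM2l ?divr_ge0 ?frob2_ge0//.
by rewrite lerDl.
Qed.

Lemma null_seq_star a : (bseq_star a \in null_seq FU) = (a \in null_seq FU).
Proof.
apply/null_seqP/null_seqP => a0 e /a0; apply: filterS => n /=;
by rewrite frob2_adj.
Qed.

Lemma null_seqMr a b : a \in null_seq FU -> a * b \in null_seq FU.
Proof.
by rewrite -null_seq_star => /null_seqMl-/(_ (bseq_star b));
  rewrite -bseq_starM null_seq_star.
Qed.

Lemma null_seq1 : 1 \notin null_seq FU.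
Proof.
apply/negP => /null_seqP/(_ 1 ltr01) h.
have [n] := filter_ex h; rewrite ltNge => /negP; apply.
by rewrite frob2_1 divff.
Qed.

Definition wright : Type := {ideal_quot (null_seq FU)}.

HB.instance Definition _ := GRing.Zmodule.on wright.
HB.instance Definition _ : EqQuotient (bseq R) _ wright :=
  EqQuotient.on wright.

Lemma wright_eqP a b :
  reflect (\pi_wright a = \pi_wright b) (a - b \in null_seq FU).
Proof. by rewrite Quotient.idealrBE; exact: eqP. Qed.

Lemma wright_reprB a : repr (\pi_wright a) - a \in null_seq FU.
Proof. by apply/wright_eqP; rewrite reprK. Qed.

Lemma wright_ind (P : wright -> Prop) : (forall a, P (\pi_wright a)) -> forall x, P x.
Proof. by move=> Pa x; rewrite -[x]reprK. Qed.

Lemma pi_wrightD : {morph \pi_wright : a b / a + b}.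
Proof. exact: Quotient.pi_add. Qed.

Definition wright_one : wright := \pi_wright 1.
Definition wright_mul (x y : wright) : wright := \pi_wright (repr x * repr y).
Definition wright_scale (z : C) (x : wright) : wright := \pi_wright (z *: repr x).
Definition star (x : wright) : wright := \pi_wright (bseq_star (repr x)).

Lemma pi_wright_mul a b : wright_mul (\pi_wright a) (\pi_wright b) = \pi_wright (a * b).
Proof.
apply/wright_eqP; rewrite -(subrKA (a * repr (\pi_wright b))).
rewrite -mulrBl -mulrBr rpredD//.
  by rewrite null_seqMr// wright_reprB.
by rewrite null_seqMl// wright_reprB.
Qed.

Lemma pi_wright_scale z a : wright_scale z (\pi_wright a) = \pi_wright (z *: a).
Proof.
apply/wright_eqP; rewrite -scalerBr -mulr_algl.
by rewrite null_seqMl// wright_reprB.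
Qed.

Fact wright_mulA : associative wright_mul.
Proof.
by elim/wright_ind=> a; elim/wright_ind=> b; elim/wright_ind=> c;
  rewrite !pi_wright_mul mulrA.
Qed.
Fact wright_mul1l : left_id wright_one wright_mul.
Proof. by elim/wright_ind=> a; rewrite pi_wright_mul mul1r. Qed.
Fact wright_mul1r : right_id wright_one wright_mul.
Proof. by elim/wright_ind=> a; rewrite pi_wright_mul mulr1. Qed.
Fact wright_mulDl : left_distributive wright_mul +%R.
Proof.
by elim/wright_ind=> a; elim/wright_ind=> b; elim/wright_ind=> c;
  rewrite -pi_wrightD !pi_wright_mul -pi_wrightD mulrDl.
Qed.
Fact wright_mulDr : right_distributive wright_mul +%R.
Proof.
by elim/wright_ind=> a; elim/wright_ind=> b; elim/wright_ind=> c;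
  rewrite -pi_wrightD !pi_wright_mul -pi_wrightD mulrDr.
Qed.
Fact wright_one_neq0 : wright_one != 0.
Proof.
have -> : 0 = \pi_wright 0.
  by apply: (addrI (\pi_wright 0)); rewrite -pi_wrightD !addr0.
by apply/eqP => /wright_eqP; rewrite subr0; apply/negP/null_seq1.
Qed.
HB.instance Definition _ := GRing.Zmodule_isNzRing.Build wright
  wright_mulA wright_mul1l wright_mul1r wright_mulDl wright_mulDr
  wright_one_neq0.

Fact wright_scaleA z w (x : wright) :
  wright_scale z (wright_scale w x) = wright_scale (z * w) x.
Proof. by elim/wright_ind: x => a; rewrite !pi_wright_scale scalerA. Qed.
Fact wright_scale1 : left_id 1 wright_scale.
Proof. by elim/wright_ind=> a; rewrite pi_wright_scale scale1r. Qed.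
Fact wright_scaleDr : right_distributive wright_scale +%R.
Proof.
by move=> z; elim/wright_ind=> a; elim/wright_ind=> b;
  rewrite -pi_wrightD !pi_wright_scale -pi_wrightD scalerDr.
Qed.
Fact wright_scaleDl (x : wright) : {morph wright_scale^~ x : z w / z + w}.
Proof.
by elim/wright_ind: x => a z w;
  rewrite !pi_wright_scale -pi_wrightD scalerDl.
Qed.
HB.instance Definition _ := GRing.Zmodule_isLmodule.Build C wright
  wright_scaleA wright_scale1 wright_scaleDr wright_scaleDl.

Fact wright_scaleAl (z : C) (x y : wright) : z *: (x * y) = (z *: x) * y.
Proof.
elim/wright_ind: x => a; elim/wright_ind: y => b.
rewrite -[LHS]/(wright_scale z (wright_mul _ _)).
rewrite -[RHS]/(wright_mul (wright_scale z _) _).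
by rewrite !(pi_wright_mul, pi_wright_scale) scalerAl.
Qed.
HB.instance Definition _ :=
  GRing.Lmodule_isLalgebra.Build C wright wright_scaleAl.
Fact wright_scaleAr (z : C) (x y : wright) : z *: (x * y) = x * (z *: y).
Proof.
elim/wright_ind: x => a; elim/wright_ind: y => b.
rewrite -[LHS]/(wright_scale z (wright_mul _ _)).
rewrite -[RHS]/(wright_mul _ (wright_scale z _)).
by rewrite !(pi_wright_mul, pi_wright_scale) scalerAr.
Qed.
HB.instance Definition _ :=
  GRing.Lalgebra_isAlgebra.Build C wright wright_scaleAr.

Lemma pi_wrightM : {morph \pi_wright : a b / a * b}.
Proof. by move=> a b; exact/esym/pi_wright_mul. Qed.

Lemma pi_wright1 : \pi_wright 1 = 1.
Proof. by []. Qed.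

Lemma pi_wrightZ z a : \pi_wright (z *: a) = z *: \pi_wright a.
Proof. exact/esym/pi_wright_scale. Qed.

Lemma pi_star a : star (\pi_wright a) = \pi_wright (bseq_star a).
Proof.
apply/wright_eqP; rewrite -bseq_starN -bseq_starD null_seq_star.
exact: wright_reprB.
Qed.

Definition normal_elt (x : wright) : Prop := star x * x = x * star x.

(* Independent of the representative, and a genuine limit: see tau_pi. *)
Definition tau (x : wright) : C :=
  lim ((ntr (repr x n) : C^o) @[n --> U]).

Lemma ultra_bounded_cvg (f : nat -> R) (K : R) :
  (forall n, `|f n| <= K) -> exists l : R, f n @[n --> U] --> l.
Proof.
move=> fK; have [] := @segment_compact R (- K) K (f @ U) _.
  by apply: (@filterE _ U) => n /=; rewrite in_itv /= -ler_norml fK.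
move=> l [_ lU]; exists l => B Bl.
have [//|nB] := in_ultra_setVsetC (f @^-1` B) FU.
by have [y [/= nBy By]] := lU (~` B) B nB Bl.
Qed.

Lemma cvg_complexP (f : nat -> C) (l : C) :
  (forall e : R, 0 < e -> \forall n \near U, normc (l - f n) < e) <->
  (f n : C^o) @[n --> U] --> (l : C^o).
Proof.
split=> [fl|fl e e0].
  apply/(@cvgrPdist_lt C C^o) => e e0.
  have [eim ere] : complex.Im e = 0 /\ 0 < complex.Re e.
    by move: e0; rewrite ltcE /= => /andP[/eqP-> ->].
  have -> : e = (complex.Re e)%:C%C by rewrite [LHS]complexE eim mulr0 addr0.
  by apply: filterS (fl _ ere) => n; rewrite -ltcR.
have /(_ _ e%:C%C) := (@cvgrPdist_lt C C^o _ _ _ _ _).1 fl.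
rewrite ltcR => /(_ e0); apply: filterS => n.
by rewrite -ltcR.
Qed.

Lemma ntr_cvg a : exists l : C, (ntr (a n) : C^o) @[n --> U] --> (l : C^o).
Proof.
have [K aK] := bseqP a.
have normK n : normc (ntr (a n)) <= K.
  exact: le_trans (normc_ntr_opnorm _) (aK n).
have ReK n : `|complex.Re (ntr (a n))| <= K.
  apply: le_trans (normK n); case: (ntr (a n)) => x y /=.
  by rewrite -sqrtr_sqr ler_wsqrtr// lerDl sqr_ge0.
have ImK n : `|complex.Im (ntr (a n))| <= K.
  apply: le_trans (normK n); case: (ntr (a n)) => x y /=.
  by rewrite -sqrtr_sqr ler_wsqrtr// lerDr sqr_ge0.
have [x xP] := ultra_bounded_cvg ReK.
have [y yP] := ultra_bounded_cvg ImK.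
exists (x +i* y)%C; apply/cvg_complexP => e e0.
have e2 : 0 < e / 2 by rewrite divr_gt0.
have /cvgrPdist_lt/(_ _ e2) hx := xP.
have /cvgrPdist_lt/(_ _ e2) hy := yP.
apply: filterS2 hx hy => n; case: (ntr (a n)) => u v /= xu yv.
have -> : Num.sqrt ((x - u) ^+ 2 + (y - v) ^+ 2) =
    normc ((x - u)%:C + 'i * (y - v)%:C)%C.
  by have <- := complexE ((x - u) +i* (y - v))%C.
apply: (le_lt_trans (normcD _ _)); rewrite normcM /= expr0n expr1n /= add0r.
rewrite sqrtr1 mul1r !addr0 !sqrtr_sqr; move: xu yv.
by move=> xu yv; rewrite [ltRHS]splitr ltrD.
Qed.

Lemma tau_pi a : (ntr (a n) : C^o) @[n --> U] --> (tau (\pi_wright a) : C^o).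
Proof.
have [l rl] := ntr_cvg (repr (\pi_wright a)).
have -> : tau (\pi_wright a) = l.
  exact: (@cvg_lim C^o (@norm_hausdorff C C^o) nat U).
apply/cvg_complexP => e e0.
have e2 : 0 < e / 2 by rewrite divr_gt0.
have /cvg_complexP/(_ _ e2) hr := rl.
have /null_seqP/(_ _ (exprn_gt0 2 e2)) hd := wright_reprB a.
apply: filterS2 hr hd => n hr hd.
have -> : l - ntr (a n) =
    (l - ntr (repr (\pi_wright a) n)) + ntr (repr (\pi_wright a) n - a n).
  by rewrite /ntr linearB /= mulrBl addrA subrK.
apply: (le_lt_trans (normcD _ _)); rewrite [ltRHS]splitr ltrD//.
rewrite -(@ltr_pXn2r _ 2)// ?nnegrE ?normc_ge0 ?(ltW e2)//.
exact: le_lt_trans (normc_ntr _) hd.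
Qed.

End WrightFactor.

(* Main.v *)
Require Import Defs.
From mathcomp Require Import all_boot all_order all_fingroup all_algebra.
From mathcomp Require Import complex zify ring lra.
From mathcomp Require Import all_classical all_reals all_analysis.
Import Order.TTheory GRing.Theory Num.Theory.
Import numFieldNormedType.Exports.
Import Normc.
Local Open Scope ring_scope.

Set Implicit Arguments.
Unset Strict Implicit.
Unset Printing Implicit Defensive.

(** The proof lifts the statement to matrices, with bounds that do not depend
on the size.

A normal matrix with trace zero is unitarily equivalent to a diagonal matrix
whose entries sum to zero.  If all partial sums of these entries, taken in some
order, are bounded, the diagonal matrix is the commutator of a weighted cyclic
shift, the weights being the partial sums, and an unweighted cyclic shift
([diag_commutator]).  In the plane an order with partial sums at most twice the
largest modulus always exists, whatever the number of terms: this is the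
Steinitz lemma ([steinitz]), proved with the Grinberg-Sevastyanov argument on
weights in a polytope.  So a normal matrix of norm K and trace zero is [B, C]
with norms of B and C bounded in terms of K alone
([normal_trace0_commutator]).

A normal element T of the quotient lifts to a bounded sequence of matrices A
that are only almost normal, in the sense that [A^*, A] tends to zero in the
normalized Hilbert-Schmidt norm.  Such an A is close, in the same norm, to a
genuinely normal matrix of comparable operator norm ([almost_normal]).  In a
basis that diagonalizes the real part of A, with diagonal entries r_i, the
commutator controls the sum of (r_i - r_j)^2 |A_ij|^2.  The spectrum is cut into
intervals, the entries of A between different intervals are erased, and the real
part is made constant on each interval: the two parts then commute.  Entries
with r_i close to r_j may be erased when a cut falls between them, but averaging
over translates of the partition shows that for one of them the erased mass is
small.

Subtracting from the normal matrix its normalized trace, which tends to zero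
because tau T = 0, gives bounded sequences B and C such that A - [B, C] tends to
zero in the normalized Hilbert-Schmidt norm ([near_commutator]); their classes
are the required elements. *)

(** * The Steinitz lemma in the plane *)

(** The pairs (1, v i) live in a space of dimension d + 1, so more than d + 1 of
them are linearly dependent. *)
Lemma exists_affine_relation (F : fieldType) (I : finType) (d : nat)
    (v : I -> 'rV[F]_d) (A : {set I}) :
  (d.+1 < #|A|)%N ->
  exists c : I -> F, [/\ exists2 i, i \in A & c i != 0,
    forall i, i \notin A -> c i = 0,
    \sum_(i in A) c i = 0 & \sum_(i in A) c i *: v i = 0].
Proof.
move=> dA; have /card_gt0P[a aA] : (0 < #|A|)%N by exact: leq_ltn_trans dA.
pose M : 'M[F]_(#|A|, 1 + d) := \matrix_k row_mx 1%:M (v (enum_val k)).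
have /rowV0Pn[u /sub_kermxP uM u0] : kermx M != 0.
  rewrite kermx_eq0 -row_leq_rank -ltnNge.
  exact: leq_ltn_trans (rank_leq_col M) dA.
exists (fun i => if i \in A then u 0 (enum_rank_in aA i) else 0).
have uE : row_mx (\sum_k (u 0 k)%:M) (\sum_k u 0 k *: v (enum_val k)) =
    0 :> 'rV_(1 + d).
  rewrite -uM mulmx_sum_row.
  under [RHS]eq_bigr do rewrite rowK scale_row_mx scalemx1.
  by elim/big_rec3 : _ => [|k x y z _ <-];
    rewrite ?row_mx0// add_row_mx.
have /eq_row_mx[u1 uv] : row_mx (\sum_k (u 0 k)%:M)
  (\sum_k u 0 k *: v (enum_val k)) = row_mx 0 0 :> 'rV_(1 + d).
  by rewrite uE row_mx0.
split.
- have [k uk] : exists k, u 0 k != 0.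
    by apply/existsP; apply: contraR u0 => /existsPn u0; apply/eqP/rowP => k;
      rewrite mxE; apply/eqP; move: (u0 k); rewrite negbK.
  by exists (enum_val k); rewrite ?enum_valP// enum_valK_in.
- by move=> i /negPf ->.
- rewrite big_enum_val /=.
  under eq_bigr do rewrite enum_valP enum_valK_in.
  have := congr1 (fun B : 'M[F]_1 => B 0 0) u1.
  rewrite summxE [RHS]mxE => {2}<-.
  by apply: eq_bigr => k _; rewrite mxE mulr1n.
- rewrite big_enum_val /= -[RHS]uv; apply: eq_bigr => k _.
  by rewrite enum_valP enum_valK_in.
Qed.

(** Weights at a vertex of the polytope cut out by the d + 1 linear constraints
have at most d + 1 values strictly between 0 and 1.  If none of them were zero,
the total deficit d + 1 would be a sum of at most d + 1 terms, each less than 1.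
Instead of a vertex, one moves along affine relations between the vectors of
fractional weight until a weight reaches 0 or the number of weights less than 1
drops. *)
Lemma exists_weights_with_zero (F : realFieldType) (I : finType) (d : nat)
    (v : I -> 'rV[F]_d) (A : {set I}) (w : I -> F) :
  (forall i, i \in A -> 0 <= w i <= 1) ->
  \sum_(i in A) (1 - w i) = d.+1%:R ->
  exists w' : I -> F, [/\ forall i, i \in A -> 0 <= w' i <= 1,
    \sum_(i in A) (1 - w' i) = d.+1%:R,
    \sum_(i in A) w' i *: v i = \sum_(i in A) w i *: v i &
    exists2 i, i \in A & w' i = 0].
Proof.
have [N] := ubnP #|[set i in A | w i < 1]|.
elim: N w => // N IH w; rewrite ltnS => wN w01 wd.
have [/exists_inP[i iA /eqP wi]|/exists_inPn wn0] :=
  boolP [exists i in A, w i == 0]; first by exists w; split=> //; exists i.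
have w0 i : i \in A -> 0 < w i.
  by move=> iA; rewrite lt0r wn0//; case/andP: (w01 i iA).
pose B := [set i in A | w i < 1].
have BA i : i \in B -> i \in A by rewrite inE => /andP[].
have wB i : i \in A -> i \notin B -> w i = 1.
  move=> iA; rewrite inE iA /= -leNgt => w1; apply/eqP.
  by rewrite eq_le w1; case/andP: (w01 i iA) => _ ->.
have Bd : \sum_(i in B) (1 - w i) = d.+1%:R.
  rewrite -wd [RHS](bigID (mem B)) /= [X in _ = _ + X]big1 ?addr0.
    by apply: eq_bigl => i; rewrite !inE; case: (i \in A).
  by move=> i /andP[iA iB]; rewrite (wB i)// subrr.
have dB : (d.+1 < #|B|)%N.
  have [j jB] : exists j, j \in B.
    apply/set0Pn; apply/eqP => B0; move: Bd; rewrite B0 big_set0 => /eqP.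
    by rewrite eq_sym pnatr_eq0.
  rewrite -(ltr_nat F) -Bd -sumr_const; apply: ltr_sum.
    by apply/hasP; exists j => //; rewrite mem_index_enum.
  by move=> i /BA/w0; rewrite ltrBlDr ltrDl.
have [c [[j jB cj] cB c1 cv]] := @exists_affine_relation _ _ _ v _ dB.
have sumBA (V : nmodType) (f : I -> V) : (forall i, i \notin B -> f i = 0) ->
    \sum_(i in A) f i = \sum_(i in B) f i.
  move=> fB; rewrite [LHS]big_rmcond => [|i iA].
    by rewrite [RHS]big_rmcond.
  by apply: fB; exact: contra (@BA i) iA.
have c1A : \sum_(i in A) c i = 0 by rewrite sumBA.
have cvA : \sum_(i in A) c i *: v i = 0.
  by rewrite sumBA// => i /cB ->; rewrite scale0r.
(* t i is the time at which the weight of i leaves the unit interval. *)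
pose t i := if 0 < c i then (1 - w i) / c i else w i / - c i.
have [k /andP[kB ck] tk] : exists2 k, (k \in B) && (c k != 0) &
    forall i, i \in B -> c i != 0 -> t k <= t i.
  pose P := [pred i | (i \in B) && (c i != 0)].
  have Pj : P j by rewrite /= jB cj.
  case: (@Order.TotalTheory.arg_minP _ _ _ j P t Pj) => k Pk km.
  by exists k => // i iB ci; apply: km; rewrite /= iB.
have tk0 : 0 <= t k.
  have /andP[wk0 wk1] := w01 _ (BA _ kB); rewrite /t; case: ltP => ck0.
    by rewrite divr_ge0 ?subr_ge0// ltW.
  by rewrite divr_ge0// oppr_ge0.
pose w' i := w i + t k * c i.
have w'01 i : i \in A -> 0 <= w' i <= 1.
  move=> iA; have /andP[wi0 wi1] := w01 _ iA; rewrite /w'.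
  have [->|ci] := eqVneq (c i) 0; first by rewrite mulr0 addr0 wi0.
  have iB : i \in B by apply: contraNT ci => /cB ->.
  have := tk i iB ci; rewrite {2}/t; case: ltP => ci0.
    rewrite ler_pdivlMr// => h; rewrite -lerBrDl h andbT.
    by rewrite addr_ge0// mulr_ge0// ltW.
  have ci1 : 0 < - c i by rewrite oppr_gt0 lt_neqAle ci.
  rewrite ler_pdivlMr// mulrN => h.
  apply/andP; split; first lra.
  have : t k * c i <= 0 by rewrite mulr_ge0_le0.
  lra.
have w'd : \sum_(i in A) (1 - w' i) = d.+1%:R.
  rewrite -wd; under eq_bigr do rewrite /w' opprD addrA.
  by rewrite sumrB -mulr_sumr c1A mulr0 subr0.
have w'v : \sum_(i in A) w' i *: v i = \sum_(i in A) w i *: v i.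
  under eq_bigr do rewrite /w' scalerDl -scalerA.
  by rewrite big_split /= -scaler_sumr cvA scaler0 addr0.
have [w'k|w'k] : w' k = 0 \/ w' k = 1.
  rewrite /w' /t; case: ltP => _; [right|left].
    by rewrite divfK// addrC subrK.
  by rewrite invrN mulrN mulNr divfK// subrr.
  by exists w'; split=> //; exists k => //; exact: BA.
have [|||w'' [w''01 w''d w''v w''0]] := IH w' => //.
  apply: leq_trans wN; apply: proper_card; apply/properP; split.
    apply/fintype.subsetP => i; rewrite !inE => /andP[iA]; rewrite iA /=.
    have [iB _|iB] := boolP (i \in B); first by move: iB; rewrite inE iA.
    by rewrite /w' (wB _ iA iB) (cB _ iB) mulr0 addr0.
  by exists k => //; rewrite inE w'k ltxx andbF.
by exists w''; split => //; rewrite w''v.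
Qed.

Lemma normc_real (R : realType) (x : R) : normc x%:C%C = `|x|.
Proof. by rewrite /= expr0n addr0 sqrtr_sqr. Qed.

Definition real_coords (R : realType) (z : R[i]) : 'rV[R]_2 :=
  \row_j (if j == 0 then complex.Re z else complex.Im z).

Lemma sum_real_coords (R : realType) (I : finType) (A : {set I})
    (w : I -> R) (v : I -> R[i]) :
  \sum_(i in A) w i *: real_coords (v i) =
  real_coords (\sum_(i in A) (w i)%:C%C * v i).
Proof.
have ReM (x : R) (z : R[i]) : complex.Re (x%:C%C * z) = x * complex.Re z.
  by case: z => a b /=; ring.
have ImM (x : R) (z : R[i]) : complex.Im (x%:C%C * z) = x * complex.Im z.
  by case: z => a b /=; ring.
apply/rowP => j; rewrite summxE mxE.
case: ifP => j0; rewrite raddf_sum; apply: eq_bigr => i _;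
by rewrite !mxE j0 -?ReM -?ImM.
Qed.

Lemma real_coords0 (R : realType) (z : R[i]) : real_coords z = 0 -> z = 0.
Proof.
case: z => a b /rowP z0; have := z0 0; have := z0 1.
by rewrite !mxE /= => -> ->.
Qed.

Lemma normc_sum_le (R : realType) (I : Type) (r : seq I) (P : pred I)
    (f : I -> R[i]) (g : I -> R) :
  (forall i, P i -> normc (f i) <= g i) ->
  normc (\sum_(i <- r | P i) f i) <= \sum_(i <- r | P i) g i.
Proof.
move=> fg; rewrite -big_filter -[leRHS]big_filter.
apply: (le_trans (normc_sum _ _)); rewrite !big_filter.
exact: ler_sum.
Qed.

(** The vectors are removed one at a time, the last of the ordering first.  The
weights certify that the set A of remaining vectors has a small sum: since the
weighted sum vanishes, the sum over A is a combination with coefficients 1 - w i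
of total mass 2.  Passing from A to A minus a point requires weights of deficit
2 on the smaller set; scaling w raises its deficit to 3, and a weight equal to
zero can then be dropped. *)
Lemma steinitz_set (R : realType) (I : finType) (v : I -> R[i]) (K : R)
    (A : {set I}) :
  0 <= K -> (forall i, normc (v i) <= K) ->
  (#|A| <= 2)%N \/ (exists w : I -> R, [/\ forall i, i \in A -> 0 <= w i <= 1,
    \sum_(i in A) (1 - w i) = 2 & \sum_(i in A) (w i)%:C%C * v i = 0]) ->
  exists s : seq I, [/\ uniq s, s =i A &
    forall k, normc (\sum_(i <- take k s) v i) <= 2 * K].
Proof.
move=> K0 vK; have [N] := ubnP #|A|.
elim: N A => // N IH A; rewrite ltnS => AN wA.
have [A2|A3] := leqP #|A| 2.
  exists (enum A); split; [exact: enum_uniq|by move=> i; rewrite mem_enum|].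
  move=> k; apply: le_trans (@normc_sum_le _ _ _ xpredT _ (fun=> K) _) _ => //.
  rewrite big_const_seq count_predT iter_addr_0 -[leLHS]mulr_natl ler_wpM2r//.
  rewrite ler_nat; apply: leq_trans A2; rewrite cardE size_take.
  by case: ltnP => // /ltnW.
case: wA => [|[w [w01 wd wv]]]; first by rewrite leqNgt A3.
(* The total weight of w is #|A| - 2; multiplying by q makes it #|A| - 3. *)
pose q : R := (#|A|%:R - 3) / (#|A|%:R - 2).
have A3r : 3 <= #|A|%:R :> R by rewrite ler_nat.
have q0 : 0 <= q by rewrite divr_ge0//; lra.
have q1 : q <= 1 by rewrite ler_pdivrMr; lra.
have sw : \sum_(i in A) w i = #|A|%:R - 2.
  by move: wd; rewrite sumrB sumr_const => <-; ring.
have [||w' [w'01 w'd w'v [a aA wa]]] :=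
  @exists_weights_with_zero R I 2 (fun i => real_coords (v i)) A
    (fun i => q * w i).
- move=> i /w01/andP[wi0 wi1]; rewrite mulr_ge0//=.
  by rewrite -[leRHS]mulr1 ler_pM.
- by rewrite sumrB sumr_const -mulr_sumr sw divfK; lra.
have w'v0 : \sum_(i in A) (w' i)%:C%C * v i = 0.
  apply: real_coords0; rewrite -sum_real_coords w'v sum_real_coords.
  under eq_bigr do rewrite rmorphM -mulrA.
  rewrite -mulr_sumr wv mulr0; apply/rowP => j.
  by rewrite !mxE; case: ifP.
have [||s [us sA sv]] := IH (A :\ a).
- by apply: leq_trans AN; rewrite [in X in (_ < X)%N](cardsD1 a) aA.
- right; exists w'; split.
  + by move=> i; rewrite inE => /andP[_ /w'01].
  + by move: w'd; rewrite (big_setD1 a)//= wa; lra.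
  + by move: w'v0; rewrite (big_setD1 a)//= wa mul0r add0r.
exists (rcons s a); split.
- by rewrite rcons_uniq us sA !inE eqxx.
- move=> i; rewrite mem_rcons inE sA !inE.
  by case: eqVneq => [->|].
move=> k; rewrite -cats1 take_cat; case: ltnP => [_ //|sk].
case E: (k - size s)%N => [|l] /=; first by rewrite cats0 -[s]take_size.
rewrite cats1 (perm_big (enum A)); last first.
  rewrite uniq_perm ?rcons_uniq ?enum_uniq ?us ?sA ?inE ?eqxx// => i.
  by rewrite mem_rcons inE sA mem_enum !inE; case: eqVneq => [->|].
rewrite big_enum /=.
have -> : \sum_(i in A) v i = \sum_(i in A) (1 - w i)%:C%C * v i.
  rewrite -[LHS]subr0 -[X in _ - X]wv -sumrB; apply: eq_bigr => i _.
  by rewrite rmorphB rmorph1 mulrBl mul1r.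
rewrite -wd mulr_suml; apply: normc_sum_le => i /w01/andP[wi0 wi1].
by rewrite normcM normc_real ger0_norm ?subr_ge0// ler_wpM2l// subr_ge0.
Qed.

Lemma steinitz (R : realType) (I : finType) (v : I -> R[i]) (K : R) :
  0 <= K -> (forall i, normc (v i) <= K) -> \sum_i v i = 0 ->
  exists s : seq I, [/\ uniq s, forall i, i \in s &
    forall k, normc (\sum_(i <- take k s) v i) <= 2 * K].
Proof.
move=> K0 vK v0; have [|s [us sI sv]] := @steinitz_set R I v K [set: I] K0 vK.
  have [I2|I3] := leqP #|[set: I]| 2; [by left|right].
  have I3r : 3 <= #|[set: I]|%:R :> R by rewrite ler_nat.
  exists (fun=> 1 - 2 / #|[set: I]|%:R); split.
  - by move=> _ _; rewrite subr_ge0 lerBlDr lerDl ler_pdivrMr ?divr_ge0//; lra.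
  - by rewrite sumr_const subKr -[LHS]mulr_natr divfK//; lra.
  - rewrite -mulr_sumr; under eq_bigl do rewrite inE.
    by rewrite v0 mulr0.
by exists s; split=> // i; rewrite sI inE.
Qed.

(** * Trace zero normal matrices are commutators *)

Lemma frob2_isometryl (R : realType) (m n p : nat) (P : 'M[R[i]]_(m, n))
    (A : 'M[R[i]]_(n, p)) :
  ctrmx P *m P = 1%:M -> frob2 (P *m A) = frob2 A.
Proof.
move=> P1; apply: (@complexI R); rewrite -!trace_adj_mul ctrmxM.
by rewrite mulmxA -(mulmxA _ _ P) P1 mulmx1.
Qed.

Lemma frob2_isometryr (R : realType) (m n p : nat) (P : 'M[R[i]]_(n, p))
    (A : 'M[R[i]]_(m, n)) :
  P *m ctrmx P = 1%:M -> frob2 (A *m P) = frob2 A.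
Proof.
move=> P1; rewrite -frob2_adj ctrmxM frob2_isometryl ?frob2_adj//.
by rewrite ctrmxK.
Qed.

Lemma opnorm_isometry_le (R : realType) (n : nat) (P : 'M[R[i]]_n) :
  ctrmx P *m P = 1%:M -> opnorm P <= 1.
Proof.
move=> P1; apply: opnorm_le => // v; rewrite mul1r.
by rewrite -(@ler_pXn2r _ 2)// ?nnegrE ?l2norm_ge0// !frob2_l2norm
  frob2_isometryl.
Qed.

Lemma mulmx_conj (R : pzRingType) (n : nat) (P Q A B : 'M[R]_n) :
  Q *m P = 1%:M -> P *m (A *m B) *m Q = (P *m A *m Q) *m (P *m B *m Q).
Proof. by move=> QP; rewrite !mulmxA -(mulmxA _ Q P) QP mulmx1. Qed.

Lemma opnorm_conj_le (R : realType) (n : nat) (P A : 'M[R[i]]_n) :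
  P *m ctrmx P = 1%:M -> opnorm (P *m A *m ctrmx P) <= opnorm A.
Proof.
move=> P1; have P1' := mulmx1C P1.
apply: (le_trans (opnormM_le _ _)); rewrite -[leRHS]mulr1.
apply: ler_pM; try exact: opnorm_ge0.
  apply: (le_trans (opnormM_le _ _)); rewrite -[leRHS]mul1r.
  by rewrite ler_wpM2r ?opnorm_ge0// opnorm_isometry_le.
by rewrite opnorm_isometry_le// ctrmxK.
Qed.

Lemma normc_entry_le (R : realType) (n : nat) (A : 'M[R[i]]_n) (i j : 'I_n) :
  normc (A i j) <= opnorm A.
Proof.
have l2delta : l2norm (delta_mx j 0 : 'cV[R[i]]_n) = 1.
  rewrite /l2norm (bigD1 j)//= mxE !eqxx big1 ?addr0; last first.
    by move=> k kj; rewrite mxE (negPf kj) normc0 expr0n.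
  by rewrite normc_real normr1 expr1n sqrtr1.
have := opnormP A (delta_mx j 0); rewrite l2delta mulr1; apply: le_trans.
rewrite -colE -(@ler_pXn2r _ 2)// ?nnegrE ?normc_ge0 ?l2norm_ge0//.
rewrite frob2_l2norm /frob2 (bigD1 i)//= big_ord1 mxE lerDl.
by apply: sumr_ge0 => k _; rewrite big_ord1 sqr_ge0.
Qed.

Lemma opnorm_diag_le (R : realType) (n : nat) (d : 'rV[R[i]]_n) (K : R) :
  0 <= K -> (forall i, normc (d 0 i) <= K) -> opnorm (diag_mx d) <= K.
Proof.
move=> K0 dK; apply: opnorm_le => // v.
rewrite -(@ler_pXn2r _ 2)// ?nnegrE ?mulr_ge0 ?l2norm_ge0//.
rewrite exprMn !frob2_l2norm /frob2 mulr_sumr; apply: ler_sum => i _.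
rewrite !big_ord1 mul_diag_mx mxE normcM exprMn ler_wpM2r ?sqr_ge0//.
by rewrite ler_pXn2r ?nnegrE ?normc_ge0.
Qed.

Lemma ctrmx_perm (R : realType) (n : nat) (s : 'S_n) :
  ctrmx (perm_mx s : 'M[R[i]]_n) = perm_mx (s^-1)%g.
Proof. by rewrite /ctrmx tr_perm_mx map_perm_mx. Qed.

(** The product of diag p with the shift by s, multiplied by the inverse shift
on the right, is diag p; on the left, it is diag p with its entries moved by
s. *)
Lemma diag_commutator (R : realType) (n : nat) (d p : 'rV[R[i]]_n) (s : 'S_n) :
  (forall i, d 0 (s i) = p 0 (s i) - p 0 i) ->
  diag_mx d = (diag_mx p *m perm_mx s) *m perm_mx (s^-1)%g -
              perm_mx (s^-1)%g *m (diag_mx p *m perm_mx s).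
Proof.
move=> dE; rewrite -mulmxA -perm_mxM mulgV perm_mx1 mulmx1 mulmxA.
apply/matrixP => i j; rewrite -row_permE -[s in perm_mx s]invgK -col_permE.
rewrite !mxE -{1}(permKV s i) dE permKV (inj_eq perm_inj).
by case: eqP => _; rewrite ?mulr1n// !mulr0n subrr.
Qed.

(** The permutation is the cyclic one of the Steinitz order s and p consists of
the partial sums along s.  The recurrence p (c i) = p i + d (c i) also holds
when c i is the first element, because the last partial sum vanishes. *)
Lemma zero_sum_diag_commutator (R : realType) (n : nat) (d : 'rV[R[i]]_n)
    (K : R) :
  0 <= K -> (forall i, normc (d 0 i) <= K) -> \sum_i d 0 i = 0 ->
  exists B C : 'M[R[i]]_n, [/\ opnorm B <= 2 * K, opnorm C <= 1 &
    diag_mx d = B *m C - C *m B].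
Proof.
move=> K0 dK d0; have [s [us sI sK]] := steinitz K0 dK d0.
pose c := perm (can_inj (prev_next us)).
pose p := \row_i \sum_(j <- take (index i s).+1 s) d 0 j.
have pc : forall i, d 0 (c i) = p 0 (c i) - p 0 i.
  move=> i; rewrite !mxE permE next_nth sI.
  have tot : \sum_(j <- s) d 0 j = 0.
    rewrite -[RHS]d0 -big_enum; apply: perm_big.
    by rewrite uniq_perm ?enum_uniq// => j; rewrite sI mem_enum.
  case: s us sI sK tot @c @p => [|x s] us sI _ tot c p; first by have := sI i.
  pose k := index i (x :: s).
  have : (k <= size s)%N by have := sI i; rewrite -index_mem.
  rewrite -[nth _ _ _]/(nth x s k) -[index i _]/k.
  rewrite leq_eqVlt => /orP[/eqP ks|ks].
    rewrite ks nth_default//= eqxx take0 big_seq1.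
    by rewrite take_size tot subr0.
  have -> : index (nth x s k) (x :: s) = k.+1.
    by rewrite -[nth x s _]/(nth x (x :: s) k.+1) index_uniq.
  rewrite [in X in _ = X - _](take_nth x) ?ltnS// -cats1 big_cat big_seq1 /=.
  by rewrite addrAC subrr add0r.
exists (diag_mx p *m perm_mx c), (perm_mx (c^-1)%g); split.
- apply: (le_trans (opnormM_le _ _)); rewrite -[leRHS]mulr1.
  rewrite ler_pM ?opnorm_ge0//.
    by apply: opnorm_diag_le => [|i]; rewrite ?mulr_ge0// mxE.
  by rewrite opnorm_isometry_le// ctrmx_perm -perm_mxM mulVg perm_mx1.
- by rewrite opnorm_isometry_le// ctrmx_perm -perm_mxM mulVg perm_mx1.
- exact: diag_commutator.
Qed.

Lemma normal_spectral (R : realType) (n : nat) (A : 'M[R[i]]_n) :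
  ctrmx A *m A = A *m ctrmx A ->
  exists (P : 'M[R[i]]_n) (d : 'rV[R[i]]_n),
    [/\ P *m ctrmx P = 1%:M, ctrmx P *m P = 1%:M,
        A = ctrmx P *m diag_mx d *m P & diag_mx d = P *m A *m ctrmx P].
Proof.
move=> nA; have /orthomx_spectralP : A \is normalmx by apply/normalmxP.
have Pu := spectral_unitarymx A; have /unitarymxP P1 := Pu.
rewrite invmx_unitary//.
move: (spectralmx A) (spectral_diag A) P1 {Pu} => P d.
rewrite -/(ctrmx P) => P1 AE.
have P1' : ctrmx P *m P = 1%:M by exact: mulmx1C.
exists P, d; split=> //.
by rewrite {1}AE !mulmxA P1 mul1mx -mulmxA P1 mulmx1.
Qed.

Lemma normal_trace0_commutator (R : realType) (n : nat) (A : 'M[R[i]]_n)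
    (K : R) :
  ctrmx A *m A = A *m ctrmx A -> \tr A = 0 -> opnorm A <= K ->
  exists B C : 'M[R[i]]_n, [/\ opnorm B <= 2 * K, opnorm C <= 1 &
    A = B *m C - C *m B].
Proof.
move=> nA trA AK; have [P [d [P1 P1' AE dE]]] := normal_spectral nA.
have K0 : 0 <= K by exact: le_trans (opnorm_ge0 A) AK.
have dK i : normc (d 0 i) <= K.
  have -> : d 0 i = diag_mx d i i by rewrite mxE eqxx mulr1n.
  apply: le_trans (normc_entry_le _ _ _) _; rewrite dE.
  exact: le_trans (opnorm_conj_le _ P1) AK.
have d0 : \sum_i d 0 i = 0.
  by rewrite -mxtrace_diag dE -mulmxA mxtrace_mulC -mulmxA P1' mulmx1.
have [B [C [BK CK dBC]]] := zero_sum_diag_commutator K0 dK d0.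
have Pc1 : ctrmx P *m ctrmx (ctrmx P) = 1%:M by rewrite ctrmxK.
have PK X : opnorm (ctrmx P *m X *m P) <= opnorm X.
  by have := opnorm_conj_le X Pc1; rewrite ctrmxK.
exists (ctrmx P *m B *m P), (ctrmx P *m C *m P); split.
- exact: le_trans (PK B) BK.
- exact: le_trans (PK C) CK.
- by rewrite -!(mulmx_conj _ _ P1) -mulmxBl -mulmxBr -dBC.
Qed.

(** * Almost normal matrices are close to normal matrices *)

(** Hermite's identity: raising k by one removes the term k %/ m and adds the
term (k + m) %/ m. *)
Lemma sum_shifted_divn (m k : nat) : (0 < m)%N ->
  (\sum_(t < m) (k + t) %/ m = k)%N.
Proof.
move=> m0; elim: k => [|k IH].
  by apply: big1 => t _; rewrite add0n divn_small.
have : (\sum_(0 <= t < m.+1) (k + t) %/ m = k + (k + m) %/ m)%N.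
  by rewrite big_nat_recr//= big_mkord IH.
rewrite big_nat_recl// addn0 divnDr// divnn m0 addn1 big_mkord addnS -addSn.
rewrite addnC => /addIn sE; rewrite -[RHS]sE.
by apply: eq_bigr => t _; rewrite addSnnS.
Qed.

(** Translates of the partition of the integers into blocks of length m are
unlikely to separate nearby integers: over the m translates, the block numbers
of l exceed those of k by l - k in total ([sum_shifted_divn]), and a translate
that separates them contributes at least 1. *)
Lemma sum_separating_shifts (m k l : nat) : (0 < m)%N ->
  (\sum_(t < m) ((k + t) %/ m != (l + t) %/ m) <= (k - l) + (l - k))%N.
Proof.
move=> m0; wlog kl : k l / (k <= l)%N => [th|].
  have [kl|/ltnW lk] := leqP k l; first exact: th.
  by rewrite addnC; under eq_bigr do rewrite eq_sym; exact: th.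
have -> : ((k - l) + (l - k) = l - k)%N by lia.
rewrite leq_subRL// -{1}(sum_shifted_divn k m0).
rewrite -[leqRHS](sum_shifted_divn l m0).
rewrite -big_split /=; apply: leq_sum => t _.
have : ((k + t) %/ m <= (l + t) %/ m)%N by rewrite leq_div2r// leq_add2r.
rewrite leq_eqVlt => /orP[/eqP ->|lt_kl]; first by rewrite eqxx addn0.
by rewrite (leq_trans _ lt_kl)// -addn1 leq_add2l leq_b1.
Qed.

(** Averaging [sum_separating_shifts] over the translates against the weights
g. *)
Lemma exists_shift_le (R : realFieldType) (I : finType) (m : nat)
    (k : I -> nat) (g : I -> I -> R) :
  (0 < m)%N -> (forall i j, 0 <= g i j) ->
  exists t : nat, m%:R *
    (\sum_i \sum_j ((k i + t) %/ m != (k j + t) %/ m)%N%:R * g i j) <=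
    \sum_i \sum_j ((k i - k j) + (k j - k i))%N%:R * g i j.
Proof.
move=> m0 g0; pose e t : R :=
  \sum_i \sum_j ((k i + t) %/ m != (k j + t) %/ m)%N%:R * g i j.
pose S : R := \sum_i \sum_j ((k i - k j) + (k j - k i))%N%:R * g i j.
have eS : \sum_(t < m) e t <= S.
  rewrite exchange_big /=; apply: ler_sum => i _.
  rewrite exchange_big /=; apply: ler_sum => j _.
  by rewrite -mulr_suml ler_wpM2r// -natr_sum ler_nat sum_separating_shifts.
have [/existsP[t te]|/existsPn te] := boolP [exists t : 'I_m, m%:R * e t <= S].
  by exists t.
exfalso; move: eS; apply/negP; rewrite -ltNge.
rewrite -(@ltr_pM2l _ m%:R) ?ltr0n// [ltRHS]mulr_sumr mulr_natl.
rewrite -[X in _ *+ X]card_ord -sumr_const.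
apply: ltr_sum => [|t _]; last by rewrite ltNge te.
by apply/hasP; exists (Ordinal m0); rewrite ?mem_index_enum.
Qed.

Lemma ctrmxD (R : realType) (m n : nat) (A B : 'M[R[i]]_(m, n)) :
  ctrmx (A + B) = ctrmx A + ctrmx B.
Proof. by apply/matrixP => i j; rewrite [RHS]mxE !ctrmxE mxE rmorphD. Qed.

Definition pinch (R : realType) (n : nat) (T : eqType) (c : 'I_n -> T)
    (A : 'M[R[i]]_n) : 'M[R[i]]_n :=
  \matrix_(i, j) if c i == c j then A i j else 0.

(** With v cut into orthogonal pieces, one per block, the rows of pinch c A in a
block act on v as those of A on the corresponding piece. *)
Lemma opnorm_pinch_le (R : realType) (n : nat) (T : eqType) (c : 'I_n -> T)
    (A : 'M[R[i]]_n) : opnorm (pinch c A) <= opnorm A.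
Proof.
apply: opnorm_le => [|v]; first exact: opnorm_ge0.
rewrite -(@ler_pXn2r _ 2)// ?nnegrE ?mulr_ge0 ?opnorm_ge0 ?l2norm_ge0//.
rewrite exprMn !frob2_l2norm.
(* The labels are replaced by elements of a finite type, to sum over them. *)
pose D i := [set j | c j == c i].
have DE i j : (D i == D j) = (c i == c j).
  apply/eqP/eqP => [/setP/(_ i)|cij]; first by rewrite !inE eqxx => /esym/eqP.
  by apply/setP => l; rewrite !inE cij.
pose vD S : 'cV[R[i]]_n := \col_j if D j == S then v j 0 else 0.
have vDE : \sum_S frob2 (vD S) = frob2 v.
  rewrite /frob2 exchange_big; apply: eq_bigr => j _ /=.
  rewrite (bigD1 (D j))//= !big_ord1 mxE eqxx big1 ?addr0// => S DS.
  by rewrite big_ord1 mxE eq_sym (negPf DS) normc0 expr0n.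
have AvE i : (pinch c A *m v) i 0 = (A *m vD (D i)) i 0.
  rewrite !mxE; apply: eq_bigr => j _; rewrite !mxE DE [c j == _]eq_sym.
  by case: ifP; rewrite ?mul0r ?mulr0.
rewrite -vDE mulr_sumr /frob2.
rewrite (partition_big D predT)//=; apply: ler_sum => S _.
apply: le_trans (frob2_opnorm A (vD S)); rewrite /frob2.
rewrite [leRHS](bigID (fun i => D i == S)) /=.
rewrite -[leLHS]addr0 lerD//.
  by apply: ler_sum => i /eqP <-; rewrite !big_ord1 AvE.
by apply: sumr_ge0 => i _; rewrite big_ord1 sqr_ge0.
Qed.

Lemma frob2_sub_pinch (R : realType) (n : nat) (T : eqType) (c : 'I_n -> T)
    (A : 'M[R[i]]_n) :
  frob2 (A - pinch c A) =
  \sum_i \sum_j (c i != c j)%:R * normc (A i j) ^+ 2.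
Proof.
apply: eq_bigr => i _; apply: eq_bigr => j _; rewrite !mxE.
by case: eqP => _ /=; rewrite ?subrr ?normc0 ?expr0n ?mul0r// subr0 mul1r.
Qed.

Lemma frob2_diag_commutator (R : realType) (n : nat) (r : 'I_n -> R)
    (A : 'M[R[i]]_n) (d := \row_i (r i)%:C%C) :
  frob2 (diag_mx d *m A - A *m diag_mx d) =
  \sum_i \sum_j (r i - r j) ^+ 2 * normc (A i j) ^+ 2.
Proof.
apply: eq_bigr => i _; apply: eq_bigr => j _.
rewrite mul_diag_mx mul_mx_diag !mxE [A i j * _]mulrC -mulrBl -rmorphB.
by rewrite normcM normc_real exprMn real_normK ?num_real.
Qed.

(** The hypothesis says that r is the real part of A, which is thus diagonal.
The matrix N is E + Y, where E is real diagonal and constant on blocks, and Y is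
the pinching of the imaginary part of A; Y is skew-adjoint and commutes with
E. *)
Lemma normal_pinch_add_diag (R : realType) (n : nat) (T : eqType)
    (c : 'I_n -> T) (e : T -> R) (r : 'I_n -> R) (A : 'M[R[i]]_n)
    (N := pinch c A + diag_mx (\row_i (e (c i) - r i)%:C%C)) :
  A + ctrmx A = diag_mx (\row_i (2 * r i)%:C%C) ->
  ctrmx N *m N = N *m ctrmx N.
Proof.
move=> Ar; pose E : 'M[R[i]]_n := diag_mx (\row_i (e (c i))%:C%C).
pose Y := pinch c A - diag_mx (\row_i (r i)%:C%C).
have -> : N = E + Y.
  apply/matrixP => i j; rewrite !mxE rmorphB mulrnBl /=.
  by rewrite addrCA.
have conjR (x : R) : (x%:C%C : R[i])^* = x%:C%C by exact: conjc_real.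
have YE : Y *m E = E *m Y.
  rewrite mul_mx_diag mul_diag_mx; apply/matrixP => i j; rewrite !mxE.
  case: eqVneq => [->|cij]; first by rewrite mulrC.
  have -> : (i == j) = false by apply: contraNF cij => /eqP ->.
  by rewrite subr0 mulr0 mul0r.
have Es : ctrmx E = E.
  apply/matrixP => i j; rewrite !(ctrmxE, mxE) eq_sym.
  by case: eqVneq => [->|_]; rewrite ?conjC0// mulr1n conjR.
have Ys : ctrmx Y = - Y.
  apply/matrixP => i j; have /matrixP/(_ i j) := Ar.
  rewrite !(ctrmxE, mxE) rmorphB (eq_sym j i) (eq_sym (c j)).
  have [->|ij] := eqVneq i j.
    rewrite eqxx !mulr1n rmorphM rmorph_nat /= conjR => Ajj.
    have -> : (A j j)^* = 2 * (r j)%:C%C - A j j.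
      by rewrite -Ajj addrAC subrr add0r.
    by ring.
  rewrite !mulrb /= => /eqP; rewrite addr_eq0 => /eqP ->.
  by case: ifP => _; rewrite ?conjC0 !subr0 ?opprK ?oppr0.
rewrite ctrmxD Es Ys; clearbody E Y.
rewrite !(mulmxDl, mulmxDr, mulNmx, mulmxN) YE.
by rewrite !addrA addrK subrK.
Qed.

(** The bins of the integers k i have width h, and m consecutive bins form a
block, so the real part moves by at most m * h.  The inequality
|k i - k j| <= 2 + ((r i - r j) / h)^2 turns the average of [exists_shift_le]
into the commutator of r with A. *)
Lemma almost_normal_diag (R : realType) (n : nat) (r : 'I_n -> R)
    (A : 'M[R[i]]_n) (K h : R) (m : nat) :
  A + ctrmx A = diag_mx (\row_i (2 * r i)%:C%C) ->
  opnorm A <= K -> 0 < h -> (0 < m)%N ->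
  exists N : 'M[R[i]]_n, [/\ ctrmx N *m N = N *m ctrmx N,
    opnorm N <= 2 * (K + m%:R * h) &
    frob2 (A - N) <= 2 * (n%:R * (m%:R * h) ^+ 2 + m%:R^-1 *
      (2 * frob2 A + h ^- 2 *
         \sum_i \sum_j (r i - r j) ^+ 2 * normc (A i j) ^+ 2))].
Proof.
move=> Ar AK h0 m0.
(* The bound on r makes y nonnegative, so that naturals number the bins. *)
have rK i : `|r i| <= K.
  have -> : r i = complex.Re (A i i).
    have /matrixP/(_ i i) := Ar; rewrite !(mxE, ctrmxE) eqxx mulr1n.
    by case: (A i i) => x y /(congr1 (@complex.Re R)) /=; lra.
  apply: le_trans AK; apply: le_trans (normc_entry_le A i i).
  by case: (A i i) => x y /=; rewrite -sqrtr_sqr ler_wsqrtr// lerDl sqr_ge0.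
pose y i := (r i + K) / h; pose k i := Num.truncn (y i).
have y0 i : 0 <= y i.
  by rewrite divr_ge0 ?(ltW h0)//; have := rK i; rewrite ler_norml; lra.
have ky i : (k i)%:R <= y i < (k i)%:R + 1.
  by rewrite natr1; exact: Num.Theory.truncn_itv.
have [t tP] := exists_shift_le k m0 (fun i j => sqr_ge0 (normc (A i j))).
pose c i := ((k i + t) %/ m)%N.
(* e b is the lower end of the block b. *)
pose e (b : nat) : R := h * (b%:R * m%:R - t%:R) - K.
have ce i : `|e (c i) - r i| <= m%:R * h.
  have : (c i)%:R * m%:R <= (k i)%:R + t%:R :> R.
    by rewrite -natrM -natrD ler_nat leq_trunc_div.
  have : (k i)%:R + t%:R + 1 <= (c i)%:R * m%:R + m%:R :> R.
    rewrite -natrM -!natrD natr1 ler_nat -mulSnr.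
    by rewrite -ltn_divLR.
  have -> : r i = h * y i - K by rewrite /y mulrC divfK ?gt_eqF// addrK.
  have /andP[] := ky i; move: (k i) (y i) => kk yy k1 k2 k3 k4.
  rewrite /e opprB addrA subrK -mulrBr normrM (gtr0_norm h0) mulrC.
  by rewrite ler_wpM2r ?(ltW h0)// ler_norml; lra.
pose d := \row_i (e (c i) - r i)%:C%C.
exists (pinch c A + diag_mx d); split.
- exact: normal_pinch_add_diag.
- apply: le_trans (opnormD_le _ _) _; apply: ler_wpM2l => //; apply: lerD.
    exact: le_trans (opnorm_pinch_le _ _) AK.
  apply: opnorm_diag_le => [|i]; first by rewrite mulr_ge0 ?(ltW h0).
  by rewrite mxE normc_real.
rewrite opprD addrA; apply: le_trans (frob2D _ _) _.
rewrite ler_wpM2l// [leLHS]addrC lerD//.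
  have -> : frob2 (- diag_mx d) = \sum_i (e (c i) - r i) ^+ 2.
    apply: eq_bigr => i _; rewrite (bigD1 i)//= big1 ?addr0.
      rewrite !mxE eqxx mulr1n -rmorphN normc_real normrN.
      by rewrite real_normK ?num_real.
    move=> j ji; rewrite !mxE eq_sym (negPf ji) mulr0n oppr0 normc0.
    by rewrite expr0n.
  rewrite mulr_natl -[X in _ *+ X]card_ord -sumr_const; apply: ler_sum => i _.
  rewrite -real_normK ?num_real// ler_pXn2r ?nnegrE//.
  by rewrite mulr_ge0 ?(ltW h0).
rewrite frob2_sub_pinch mulrC ler_pdivlMr ?ltr0n// mulrC.
apply: le_trans tP _; rewrite /frob2 !mulr_sumr -big_split.
apply: ler_sum => i _ /=.
rewrite !mulr_sumr -big_split; apply: ler_sum => j _ /=.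
rewrite [X in _ + X]mulrA -mulrDl ler_wpM2r ?sqr_ge0//.
have -> : r i - r j = h * (y i - y j).
  by rewrite /y -mulrBl mulrC divfK ?gt_eqF// opprD addrACA subrr addr0.
rewrite exprMn mulKf ?expf_neq0 ?gt_eqF//.
have := ky i; have := ky j; move: (k i) (k j) (y i) (y j) => ki kj yi yj.
move=> /andP[j1 j2] /andP[i1 i2].
have [ij|/ltnW ij] := leqP ki kj.
  have -> : (ki - kj + (kj - ki) = kj - ki)%N by lia.
  rewrite natrB//; have := sqr_ge0 (yj - yi - 1 / 2); lra.
have -> : (ki - kj + (kj - ki) = ki - kj)%N by lia.
by rewrite natrB//; have := sqr_ge0 (yi - yj - 1 / 2); lra.
Qed.

Lemma ctrmxN (R : realType) (m n : nat) (A : 'M[R[i]]_(m, n)) :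
  ctrmx (- A) = - ctrmx A.
Proof. by apply/matrixP => i j; rewrite [RHS]mxE !ctrmxE mxE rmorphN. Qed.

Lemma ctrmx_scalar (R : realType) (n : nat) (z : R[i]) :
  ctrmx (z%:M : 'M[R[i]]_n) = z^*%:M.
Proof.
apply/matrixP => i j; rewrite ctrmxE !mxE eq_sym.
by case: eqP; rewrite ?mulr1n ?mulr0n ?conjC0.
Qed.

Lemma ctrmx_diag (R : realType) (n : nat) (d : 'rV[R[i]]_n) :
  ctrmx (diag_mx d) = diag_mx (\row_i (d 0 i)^*).
Proof.
apply/matrixP => i j; rewrite ctrmxE !mxE eq_sym.
by case: eqVneq => [->|]; rewrite ?mulr1n ?mulr0n ?conjC0.
Qed.

Lemma frob2_scale_real (R : realType) (m n : nat) (x : R)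
    (A : 'M[R[i]]_(m, n)) : frob2 (x%:C%C *: A) = x ^+ 2 * frob2 A.
Proof. by rewrite frob2Z normc_real real_normK ?num_real. Qed.

Lemma frob2_le_opnorm (R : realType) (n : nat) (A : 'M[R[i]]_n) :
  frob2 A <= n%:R * opnorm A ^+ 2.
Proof.
by have := frob2_opnorm A (1%:M : 'M[R[i]]_n); rewrite mulmx1 frob2_1 mulrC.
Qed.

Lemma real_part_diagonalization (R : realType) (n : nat) (A : 'M[R[i]]_n) :
  exists (P : 'M[R[i]]_n) (r : 'I_n -> R), P *m ctrmx P = 1%:M /\
    P *m A *m ctrmx P + ctrmx (P *m A *m ctrmx P) =
    diag_mx (\row_i (2 * r i)%:C%C).
Proof.
pose H := A + ctrmx A.
have Hs : ctrmx H = H by rewrite ctrmxD ctrmxK addrC.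
have [|P [d [P1 _ _ dE]]] := @normal_spectral _ _ H; first by rewrite Hs.
exists P, (fun i => complex.Re (d 0 i) / 2); split=> //.
rewrite !ctrmxM ctrmxK -mulmxA -mulmxDr -mulmxDl mulmxA -/H -dE.
congr diag_mx; apply/rowP => i; rewrite mxE mulrC divfK ?pnatr_eq0//.
have /matrixP/(_ i i) : ctrmx (diag_mx d) = diag_mx d.
  by rewrite dE !ctrmxM ctrmxK Hs mulmxA.
rewrite ctrmx_diag !mxE eqxx !mulr1n.
case: (d 0 i) => a b /(congr1 (@complex.Im R)) /= ab.
by congr Complex; lra.
Qed.

(** With h = s^2 and about 1 / s bins per block, both the displacement m * h of
the real part and the average loss 1 / m of the pinching are of order s. *)
Lemma almost_normal_at (R : realType) (n : nat) (A : 'M[R[i]]_n) (K s : R) :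
  opnorm A <= K -> 0 < s <= 1 ->
  frob2 (ctrmx A *m A - A *m ctrmx A) <= n%:R * s ^+ 4 ->
  exists N : 'M[R[i]]_n, [/\ ctrmx N *m N = N *m ctrmx N,
    opnorm N <= 2 * (K + 2) &
    frob2 (A - N) <= n%:R * ((4 * K ^+ 2 + 10) * s)].
Proof.
move=> AK /andP[s0 s1] As.
have [P [r [P1 Ar]]] := real_part_diagonalization A.
have P1' : ctrmx P *m P = 1%:M by exact: mulmx1C.
have P1c : ctrmx P *m ctrmx (ctrmx P) = 1%:M by rewrite ctrmxK.
pose X := P *m A *m ctrmx P.
have XK : opnorm X <= K by exact: le_trans (opnorm_conj_le _ P1) AK.
have Xc : ctrmx X = P *m ctrmx A *m ctrmx P by rewrite !ctrmxM ctrmxK mulmxA.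
have XD : ctrmx X *m X - X *m ctrmx X =
    P *m (ctrmx A *m A - A *m ctrmx A) *m ctrmx P.
  by rewrite Xc -!(mulmx_conj _ _ P1') mulmxBr mulmxBl.
have Xr : \sum_i \sum_j (r i - r j) ^+ 2 * normc (X i j) ^+ 2 <= n%:R * s ^+ 4.
  rewrite -frob2_diag_commutator; set d := \row_i _.
  have dE : 2 *: diag_mx d = X + ctrmx X.
    rewrite Ar -linearZ; congr diag_mx; apply/rowP => i.
    by rewrite !mxE rmorphM rmorph_nat.
  have : frob2 (2 *: (diag_mx d *m X - X *m diag_mx d)) =
      frob2 (ctrmx A *m A - A *m ctrmx A).
    rewrite scalerBr scalemxAl scalemxAr dE mulmxDl mulmxDr opprD addrACA.
    rewrite subrr add0r XD frob2_isometryr ?ctrmxK ?P1'//.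
    by rewrite frob2_isometryl.
  have -> : (2 : R[i]) = (2 : R)%:C%C by rewrite rmorph_nat.
  rewrite frob2_scale_real => DA.
  rewrite -DA in As; apply: le_trans As; rewrite ler_peMl ?frob2_ge0//.
  by rewrite -natrX ler1n.
pose m := (Num.truncn s^-1).+1.
have sV0 : 0 <= s^-1 by rewrite invr_ge0 ltW.
have /andP[ms sm] := Num.Theory.truncn_itv sV0.
have mh : m%:R * s ^+ 2 <= 2 * s.
  have : m%:R * s <= 2.
    rewrite /m -natr1 mulrDl mul1r -[leRHS]/(1 + 1) lerD//.
    by rewrite -ler_pdivlMr// div1r.
  by rewrite expr2 mulrA => ?; rewrite ler_wpM2r ?(ltW s0).
have mV : m%:R^-1 <= s.
  by rewrite -[leRHS]invrK lef_pV2 ?posrE ?invr_gt0 ?ltr0n// ltW.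
have s20 : 0 < s ^+ 2 by rewrite exprn_gt0.
have [N [nN NK AN]] := @almost_normal_diag _ _ _ _ _ _ m Ar XK s20 isT.
have mh0 : 0 <= m%:R * s ^+ 2 by rewrite mulr_ge0// ltW.
have K0 : 0 <= K by exact: le_trans (opnorm_ge0 A) AK.
exists (ctrmx P *m N *m P); split.
- have -> : ctrmx (ctrmx P *m N *m P) = ctrmx P *m ctrmx N *m P.
    by rewrite !ctrmxM ctrmxK mulmxA.
  by rewrite -!(mulmx_conj _ _ P1) nN.
- have := opnorm_conj_le N P1c; rewrite ctrmxK => h; apply: (le_trans h).
  apply: (le_trans NK); rewrite ler_wpM2l// lerD2l.
  by apply: (le_trans mh); rewrite ler_piMr.
have -> : frob2 (A - ctrmx P *m N *m P) = frob2 (X - N).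
  rewrite -(frob2_isometryr (P := ctrmx P)) ?ctrmxK ?P1'//.
  rewrite -(frob2_isometryl (P := P)) ?P1'// mulmxA mulmxBr mulmxBl.
  by rewrite !mulmxA P1 mul1mx -(mulmxA N) P1 mulmx1.
apply: (le_trans AN).
have nX : frob2 X <= n%:R * K ^+ 2.
  apply: le_trans (frob2_le_opnorm _) _; rewrite ler_wpM2l//.
  by rewrite ler_pXn2r ?nnegrE ?opnorm_ge0.
have Dn : (s ^+ 2) ^- 2 *
    \sum_i \sum_j (r i - r j) ^+ 2 * normc (X i j) ^+ 2 <= n%:R.
  by rewrite mulrC ler_pdivrMr ?exprn_gt0// -exprM.
move: Dn; set D := _ * \sum_i _ => Dn.
have D0 : 0 <= D.
  apply: mulr_ge0; first by rewrite invr_ge0 exprn_ge0// ltW.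
  apply: sumr_ge0 => i _; apply: sumr_ge0 => j _.
  by rewrite mulr_ge0 ?sqr_ge0.
have mh2 : (m%:R * s ^+ 2) ^+ 2 <= 4 * s.
  apply: (@le_trans _ _ ((2 * s) ^+ 2)).
    by rewrite ler_pXn2r ?nnegrE// mulr_ge0// ltW.
  rewrite exprMn -natrX expr2 ler_wpM2l// ler_piMr//.
  exact: ltW.
have t1 : n%:R * (m%:R * s ^+ 2) ^+ 2 <= n%:R * (4 * s) :> R.
  by rewrite ler_wpM2l.
have t2 : m%:R^-1 * (2 * frob2 X + D) <= s * (2 * (n%:R * K ^+ 2) + n%:R).
  apply: ler_pM => //.
    by apply: addr_ge0 => //; apply: mulr_ge0 => //; exact: frob2_ge0.
  by apply: lerD => //; rewrite ler_wpM2l.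
apply: (@le_trans _ _
  (2 * (n%:R * (4 * s) + s * (2 * (n%:R * K ^+ 2) + n%:R)))).
  by rewrite ler_wpM2l// lerD.
by rewrite le_eqVlt; apply/orP; left; apply/eqP; ring.
Qed.

(** One matrix N serves for every s that the defect of normality allows, since
the fourth root of the normalized defect is the smallest such s.  When this root
is 0 the matrix A is itself normal, and when it exceeds 1 there is no such s. *)
Lemma almost_normal (R : realType) (n : nat) (A : 'M[R[i]]_n) (K : R) :
  opnorm A <= K -> exists N : 'M[R[i]]_n, [/\ ctrmx N *m N = N *m ctrmx N,
    opnorm N <= 2 * (K + 2) & forall s, 0 < s <= 1 ->
      frob2 (ctrmx A *m A - A *m ctrmx A) <= n%:R * s ^+ 4 ->
      frob2 (A - N) <= n%:R * ((4 * K ^+ 2 + 10) * s)].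
Proof.
move=> AK; pose d := frob2 (ctrmx A *m A - A *m ctrmx A) / n%:R.
have K0 : 0 <= K by exact: le_trans (opnorm_ge0 A) AK.
have [A0|A0] := eqVneq (frob2 (ctrmx A *m A - A *m ctrmx A)) 0.
  exists A; split.
  - by apply/eqP; rewrite -subr_eq0; apply/eqP/frob2_eq0.
  - by apply: (le_trans AK); lra.
  - move=> s /andP[s0 _] _; rewrite subrr.
    have -> : frob2 (0 : 'M[R[i]]_n) = 0.
      by rewrite -(scale0r 0) frob2Z normc0 expr0n mul0r.
    by rewrite !mulr_ge0 ?(ltW s0)// addr_ge0// mulr_ge0// sqr_ge0.
have n0 : 0 < n%:R :> R.
  rewrite ltr0n lt0n; apply: contra_neq A0 => n0.
  by rewrite /frob2 big1// => i; have := ltn_ord i; rewrite [X in (_ < X)%N]n0.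
have d0 : 0 < d by rewrite divr_gt0// lt0r A0 frob2_ge0.
pose s := Num.sqrt (Num.sqrt d).
have s0 : 0 < s by rewrite !sqrtr_gt0.
have s4 : s ^+ 4 = d.
  by rewrite -[4%N]/(2 * 2)%N exprM !sqr_sqrtr ?sqrtr_ge0// ltW.
have [s1|s1] := leP s 1; last first.
  exists 0; split.
  - by rewrite mulmx0 mul0mx.
  - by rewrite -(scale0r 0) (le_trans (opnormZ_le _ _))// normc0 mul0r; lra.
  - move=> t /andP[t0 t1]; rewrite -ler_pdivrMl// mulrC -/d -s4.
    rewrite ler_pXn2r ?nnegrE ?(ltW s0) ?(ltW t0)// => st.
    by have := le_lt_trans t1 s1; rewrite ltNge st.
have [||N [nN NK AN]] := almost_normal_at (s := s) AK.
- by rewrite s0.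
- by rewrite s4 /d mulrC divfK ?gt_eqF.
exists N; split=> // t /andP[t0 t1]; rewrite -ler_pdivrMl// mulrC -/d -s4.
rewrite ler_pXn2r ?nnegrE ?(ltW s0) ?(ltW t0)// => st.
apply: (le_trans AN); rewrite !ler_wpM2l// ?(ltW n0)//.
by rewrite addr_ge0// mulr_ge0// sqr_ge0.
Qed.

(** * From matrices to the quotient *)

Lemma sqr_le_of_le_add (R : realFieldType) (u x y f : R) :
  0 <= u -> u <= x + y -> x ^+ 2 <= f -> u ^+ 2 <= 2 * (f + y ^+ 2).
Proof.
move=> u0 uxy xf; have xy0 := le_trans u0 uxy.
apply: (@le_trans _ _ ((x + y) ^+ 2)); first by rewrite ler_pXn2r ?nnegrE.
by have := sqr_ge0 (x - y); lra.
Qed.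

Lemma frob2N (R : realType) (m n : nat) (A : 'M[R[i]]_(m, n)) :
  frob2 (- A) = frob2 A.
Proof. by apply: eq_bigr => i _; apply: eq_bigr => j _; rewrite mxE normcN. Qed.

(** The trace of the normal approximant N is removed before writing it as a
commutator; the normalized trace of N is controlled by that of A and by the
distance from A to N. *)
Lemma near_commutator (R : realType) (n : nat) (A : 'M[R[i]]_n.+1) (K : R) :
  opnorm A <= K -> exists B C : 'M[R[i]]_n.+1,
    [/\ opnorm B <= 16 * (K + 2), opnorm C <= 1 & forall s, 0 < s <= 1 ->
      frob2 (ctrmx A *m A - A *m ctrmx A) / n.+1%:R <= s ^+ 4 ->
      frob2 (A - (B *m C - C *m B)) / n.+1%:R <=
        6 * ((4 * K ^+ 2 + 10) * s) + 4 * normc (ntr A) ^+ 2].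
Proof.
have arith (d e z t q : R) : d <= q -> z <= 2 * (d + t) ->
  e <= 2 * (d + z) -> e <= 6 * q + 4 * t by lra.
move=> AK; have [N [nN NK AN]] := almost_normal AK.
pose z := ntr N; pose M := N - z%:M.
have nM : ctrmx M *m M = M *m ctrmx M.
  rewrite /M ctrmxD ctrmxN ctrmx_scalar !(mulmxDl, mulmxDr) nN.
  rewrite !(mulNmx, mulmxN) !(mul_scalar_mx, mul_mx_scalar).
  rewrite -[z%:M]scalemx1 -[(z^*)%:M]scalemx1 !scalerA [z^* * z]mulrC.
  by rewrite addrACA.
have trM : \tr M = 0.
  by rewrite /M linearB /= mxtrace_scalar -mulr_natr divfK ?subrr ?pnatr_eq0.
have MK : opnorm M <= 8 * (K + 2).
  apply: (le_trans (opnormD_le _ _)).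
  have : opnorm (- z%:M : 'M[R[i]]_n.+1) <= opnorm N.
    rewrite -scaleN1r -scalemx1 scalerA (le_trans (opnormZ_le _ _))//.
    rewrite mulN1r normcN -[leRHS]mulr1 ler_pM ?normc_ge0 ?opnorm_ge0//.
      exact: normc_ntr_opnorm.
    exact: opnorm1_le.
  move: (opnorm _) (opnorm N) NK => u v vK uv; lra.
have [B [C [BM CM MBC]]] := normal_trace0_commutator nM trM MK.
exists B, C; split=> //; first by rewrite (le_trans BM)// mulrA -natrM.
move=> s s01 As; rewrite -MBC.
have n0 : 0 < n.+1%:R :> R by rewrite ltr0n.
have {}AN : frob2 (A - N) / n.+1%:R <= (4 * K ^+ 2 + 10) * s.
  by rewrite ler_pdivrMr// mulrC AN// mulrC -ler_pdivrMr.
have z2 : normc z ^+ 2 <= 2 * (frob2 (A - N) / n.+1%:R + normc (ntr A) ^+ 2).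
  have -> : z = ntr (N - A) + ntr A.
    by rewrite /ntr -mulrDl -linearD subrK.
  have h := normc_ntr (N - A); rewrite -[X in frob2 X]opprB frob2N in h.
  by apply: sqr_le_of_le_add h; [exact: normc_ge0|exact: normcD].
apply: arith AN z2 _; rewrite /M opprB addrCA addrC.
rewrite -[normc z ^+ 2](mulfK (lt0r_neq0 n0)) -mulrDl mulrA.
rewrite ler_wpM2r ?invr_ge0 ?(ltW n0)//.
apply: (le_trans (frob2D _ _)); rewrite ler_wpM2l// lerD2l.
by rewrite -scalemx1 frob2Z frob2_1.
Qed.

Theorem theorem2p2 (R : realType) (U : set_system nat) (FU : UltraFilter U)
    (U_nonprincipal : nonprincipal U) (T : wright R FU) :
  normal_elt T -> tau T = 0 -> Comm (wright R FU) T.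
Proof.
have arith (x y e : R) : x <= e / 2 -> y < e / 8 -> x + 4 * y < e by lra.
elim/wright_ind: T => a; rewrite /normal_elt pi_star -!pi_wrightM.
move=> /wright_eqP /null_seqP a_normal a_tau.
have [K aK] := bseqP a.
have /cvg_complexP a_tr := @tau_pi R U FU a; rewrite a_tau in a_tr.
have /all_sig[B BP] := fun n => cid (near_commutator (aK n)).
have /all_sig[C BCP] := fun n => cid (BP n).
have Bb : (B : matseq R) \in @norm_bounded R.
  by apply/norm_boundedP; exists (16 * (K + 2)) => n; have [] := BCP n.
have Cb : (C : matseq R) \in @norm_bounded R.
  by apply/norm_boundedP; exists 1 => n; have [] := BCP n.
pose b := Defs.Bseq Bb; pose c := Defs.Bseq Cb.
have TE : \pi_(wright R FU)%qT a = \pi_(wright R FU)%qT (b * c - c * b).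
  apply/wright_eqP/null_seqP => e e0.
  (* s and the bound on the trace make the two error terms of near_commutator
     at most e / 2 each. *)
  pose L := 6 * (4 * K ^+ 2 + 10).
  have L0 : 0 < L by rewrite mulr_gt0// ltr_wpDl// mulr_ge0// sqr_ge0.
  pose s := Num.min 1 (e / (2 * L)).
  have s0 : 0 < s by rewrite lt_min ltr01 divr_gt0// mulr_gt0.
  have s1 : s <= 1 by rewrite ge_min lexx.
  have sL : L * s <= e / 2.
    rewrite mulrC -ler_pdivlMr// -mulrA -invfM ge_min.
    by rewrite lexx orbT.
  have e' : 0 < e / 8 by rewrite divr_gt0.
  have eq0 : 0 < Num.sqrt (e / 8) by rewrite sqrtr_gt0.
  apply: filterS2 (a_normal _ (exprn_gt0 4 s0)) (a_tr _ eq0) => n an tn.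
  have [_ _ /(_ s)] := BCP n; rewrite s0 s1 => /(_ isT (ltW an)).
  rewrite -[(a - _) n]/(a n - (B n *m C n - C n *m B n)) => h.
  apply: (le_lt_trans h).
  rewrite mulrA -/L; apply: arith sL _.
  rewrite -[ltRHS]sqr_sqrtr ?(ltW e')// ltr_pXn2r ?nnegrE ?normc_ge0//.
  by rewrite -normcN -[X in normc X]add0r.
exists (\pi_(wright R FU)%qT b), (\pi_(wright R FU)%qT c).
rewrite TE; apply: (addIr (\pi_(wright R FU)%qT c * \pi_(wright R FU)%qT b)).
by rewrite subrK -!pi_wrightM -pi_wrightD subrK.
Qed.
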